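(* If $q,w\in L^2(I,\mathbb{R}^N)$ are both step functions, then there exist piecewise linear functions $\lambda,\gamma\in\tilde\Gamma$ such that $$\langle q*\lambda,w*\gamma\rangle=\sup_{\tilde q\in[q],\,\tilde w\in[w]}\langle\tilde q,\tilde w\rangle.$$
   Context: $I=[0,1]$; $\langle\cdot,\cdot\rangle$ is the standard inner product of $L^2(I,\mathbb{R}^N)$. $\tilde\Gamma$ is the set of absolutely continuous $\gamma:I\to I$ with $\gamma(0)=0$, $\gamma(1)=1$, $\gamma'\ge0$ a.e.; $\Gamma\subset\tilde\Gamma$ is the subset (a group under composition) of those with $\gamma'>0$ a.e. They act on the right on $L^2(I,\mathbb{R}^N)$ by $(q*\gamma)(t)=q(\gamma(t))\sqrt{\gamma'(t)}$ (equal to $0$ where $\gamma'(t)=0$). $[q]$ denotes the $L^2$-closure of the orbit $q\Gamma=\{q*\gamma:\gamma\in\Gamma\}$. A step function is a function $I\to\mathbb{R}^N$ for which $I$ is a finite disjoint union of subintervals on each of which it is constant (values at endpoints are irrelevant). Piecewise linear means continuous and affine on each of finitely many subintervals. *)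

(* Defs.v *)
From mathcomp Require Export all_boot all_order all_algebra.
From mathcomp Require Export all_classical all_reals all_analysis.
Export Order.TTheory GRing.Theory Num.Theory.
Export numFieldNormedType.Exports.
Set Implicit Arguments.
Unset Strict Implicit.
Unset Printing Implicit Defensive.
Local Open Scope classical_set_scope.
Local Open Scope ring_scope.

(* Curves I -> R^N and reparametrizations I -> I are represented by functions
   on all of R, of which only the restriction to I matters; the values of the
   derivative at the endpoints 0 and 1 are irrelevant up to null sets. *)
Definition I01 (R : realType) : set R := `[0, 1]%classic.
Arguments I01 R : clear implicits.

Definition dot (R : realType) (N : nat) (u v : 'rV[R]_N) : R :=
  \sum_(i < N) u 0 i * v 0 i.

Definition L2inner (R : realType) (N : nat) (f g : R -> 'rV[R]_N) : R :=
  (\int[lebesgue_measure]_(t in I01 R) dot (f t) (g t))%R.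

(* Extended-valued, so that it is +oo (and not a default value) on functions
   that are not square-integrable. *)
Definition L2norm (R : realType) (N : nat) (f : R -> 'rV[R]_N) : \bar R :=
  sqrte (\int[lebesgue_measure]_(t in I01 R) (dot (f t) (f t))%:E)%E.

(* Elements of L^2 are represented by their Borel representatives. *)
Definition L2 (R : realType) (N : nat) (f : R -> 'rV[R]_N) : Prop :=
  (forall i : 'I_N, measurable_fun (I01 R) (fun t => f t 0 i)) /\
  (L2norm f < +oo)%E.

Definition abs_continuous (R : realType) (f : R -> R) : Prop :=
  forall e : R, 0 < e -> exists2 d : R, 0 < d &
    forall (n : nat) (a b : 'I_n -> R),
      (forall i, 0 <= a i /\ a i <= b i /\ b i <= 1) ->
      trivIset [set: 'I_n] (fun i => `]a i, b i[%classic : set R) ->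
      \sum_(i < n) (b i - a i) < d ->
      \sum_(i < n) `|f (b i) - f (a i)| < e.

(* [derivable] is part of "g' >= 0 a.e.": [derive1 g] takes a default value at
   points of non-differentiability. *)
Definition Gamma_tilde (R : realType) (g : R -> R) : Prop :=
  [/\ (forall t, I01 R t -> I01 R (g t)),
      abs_continuous g,
      g 0 = 0,
      g 1 = 1 &
      {ae lebesgue_measure, forall t : R, I01 R t ->
        derivable g t 1 /\ 0 <= derive1 g t}].

Definition Gamma (R : realType) (g : R -> R) : Prop :=
  Gamma_tilde g /\
  {ae lebesgue_measure, forall t : R, I01 R t ->
    derivable g t 1 /\ 0 < derive1 g t}.

Definition act (R : realType) (N : nat) (q : R -> 'rV[R]_N) (g : R -> R) :
  R -> 'rV[R]_N := fun t => Num.sqrt (derive1 g t) *: q (g t).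

Definition orbit_closure (R : realType) (N : nat) (q : R -> 'rV[R]_N) :
    set (R -> 'rV[R]_N) :=
  [set f | L2 f /\ forall e : R, 0 < e ->
     exists2 g : R -> R, Gamma g & (L2norm (fun t => (f t - act q g t)%R) < e%:E)%E].

(* [P] holds for some finite subdivision 0 = s_0 < ... < s_n = 1, on each open
   piece. *)
Definition piecewise01 (R : realType) (P : set R -> Prop) : Prop :=
  exists2 s : seq R, itv_partition 0 1 s &
    forall i, (i < size s)%N ->
      P `](nth 0 (0 :: s) i), (nth 0 (0 :: s) i.+1)[%classic.

(* The values at the subdivision points are unconstrained. *)
Definition step_function (R : realType) (N : nat) (q : R -> 'rV[R]_N) : Prop :=
  piecewise01 (fun J : set R => exists c : 'rV[R]_N, forall t, J t -> q t = c).

Definition piecewise_linear (R : realType) (g : R -> R) : Prop :=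
  {within I01 R, continuous g} /\
  piecewise01 (fun J : set R => exists a b : R, forall t, J t -> g t = a * t + b).

(* Main.v *)
(** Cut the unit square into the cells [[S i, S i+1] x [T j, T j+1]] on which the
    pair [(q, w)] is constant.  A path [(g1, g2)] with [g1], [g2] in [Gamma] visits
    the cells along a monotone chain of points; inside one cell the integrand of
    [<q * g1, w * g2>] is a constant times [sqrt (g1' g2')], whose integral is by
    AM-GM at most [sqrt (dx dy)], where [dx] and [dy] are the increments of [g1]
    and [g2].  So the inner product is at most
    [sum max (0, <c i, d j>) sqrt (dx dy)], a continuous function of the chain,
    and chains form a compact set.  A maximal chain is realized by piecewise linear
    paths which are affine in the cells of positive weight and go along two sides,
    at no cost, of the others.  The bound extends from the orbits to their closures
    by continuity, and [q * lambda] lies in the closure of the orbit of [q] for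
    [lambda] piecewise linear, as the limit of [q * ((1 - e) lambda + e id)]. *)

Require Import Defs.
From mathcomp Require Import measurable_realfun ring lra zify.
Local Open Scope classical_set_scope.
Local Open Scope ring_scope.

(** * Absolutely continuous functions with nonnegative derivative *)

(** Three obstacles shape the proof. A step function is prescribed only on open pieces, so the bound
    in a cell requires times strictly between two nodes to be sent strictly inside that cell; hence
    the elements of [Gamma] are first shown to be strictly increasing, by a covering argument. Next,
    [derive1 g] takes default values where [g] is not derivable, so [act q g] may fail to be
    measurable; the upper bound is proved for its truncation to a measurable set of full measure,
    and closeness in L^2 is carried over by comparing integrals of nonnegative functions. For the
    same bound the derivative enters through the inequality [int g' <= g d - g c], which follows
    from monotonicity and Fatou's lemma. Finally, paths visit different cells in general; a chain
    therefore has one step for each of the [n * m] cells, most of them degenerate, so that all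
    chains live in one finite-dimensional cube and are cut out by closed conditions. *)

Lemma segment_additive_ind (R : realType) (P : R -> R -> Prop) (c d : R) :
  c <= d ->
  (forall x y z, P x y -> P y z -> P x z) ->
  (forall s, c <= s <= d -> exists2 e, 0 < e &
     forall x y, c <= x <= s -> s <= y <= d -> s - e < x -> y < s + e -> P x y) ->
  P c d.
Proof.
move=> cd Ptrans Ploc.
(* Real induction: the local hypothesis at [sup A] joins a point of [A] on its left to the point [b]
   on its right, so [b] is in [A], which forces [b = d]. *)
pose A := [set t : R | c <= t <= d /\ P c t].
have Ac : A c.
  split; first by rewrite lexx cd.
  have [|e e0 He] := Ploc c; first by rewrite lexx cd.
  by apply: He; rewrite ?lexx ?cd//; lra.
have supA : has_sup A by split; [exists c|exists d => t [/andP[]]].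
have cs : c <= sup A by apply: ub_le_sup => //; case: supA.
have sd : sup A <= d by apply: ge_sup; [exists c|move=> t [/andP[]]].
have [|e e0 He] := Ploc (sup A); first by rewrite cs sd.
have [t At st] := sup_adherent e0 supA.
have [/andP[ct td] Pct] := At.
have ts : t <= sup A by apply: ub_le_sup => //; case: supA.
pose b := Num.min d (sup A + e / 2).
have sb : sup A <= b by rewrite le_min sd/=; lra.
have bd : b <= d by rewrite ge_min lexx.
have Pcb : P c b.
  apply: Ptrans Pct _; apply: He; rewrite ?ct ?ts ?sb ?bd//.
  by rewrite gt_min; apply/orP; right; lra.
have bs : b <= sup A.
  apply: ub_le_sup; first by case: supA.
  by split => //; rewrite bd andbT; lra.
have -> : d = b by move: bs; rewrite /b /Num.min; case: ifPn => //; lra.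
exact: Pcb.
Qed.

Lemma derive1_approx (R : realType) (g : R -> R) (s e : R) : derivable g s 1 ->
  0 < e -> exists2 d, 0 < d &
  forall x, `|x - s| < d -> `|g x - g s - derive1 g s * (x - s)| <= e * `|x - s|.
Proof.
move=> dg e0.
have cg : (fun h : R => h^-1 *: (g (h + s) - g s)) @ 0^' --> derive1 g s.
  have := dg; rewrite /derivable /derive1.
  rewrite (_ : (fun h : R => h^-1 *: (g (h *: (1:R) + s) - g s)) =
               (fun h : R => h^-1 *: (g (h + s) - g s)))//.
  by apply/funext => h; rewrite /GRing.scale/= mulr1.
have /cvgrPdist_le/(_ _ e0)[d /= d0 Hd] := cg.
exists d => // x xsd.
have [->|xs] := eqVneq x s; first by rewrite !subrr mulr0 subr0 normr0 mulr0.
have xs0 : x - s != 0 by rewrite subr_eq0.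
have := Hd (x - s); rewrite /= sub0r normrN => /(_ xsd xs0).
rewrite subrK /GRing.scale/= => H.
rewrite -ler_pdivrMr ?normr_gt0// -normfV -normrM distrC in H *.
apply: le_trans H; rewrite le_eqVlt; apply/orP; left; apply/eqP.
by congr (`| _ |); field.
Qed.

Section monotone.
Variable R : realType.
Local Notation mu := (@lebesgue_measure R).

Lemma null_open_cover (E : set R) (e : R) : mu.-negligible E -> 0 < e ->
  exists U : set R, [/\ open U, E `<=` U & (mu U < e%:E)%E].
Proof.
move=> [N [mN N0 EN]] e0.
have [|U [oU NU UNe]] := lebesgue_regularity_outer mN _ e0.
  by rewrite [X in (X < _)%E](_ : _ = 0%E) ?ltry.
exists U; split => //; first exact: subset_trans NU.
have mU : measurable U by exact: open_measurable.
have -> : U = N `|` (U `\` N) by rewrite setDUK.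
apply: le_lt_trans UNe.
apply: (le_trans (measureU2 _ _ _)) => //; first exact: measurableD.
by rewrite [X in (X + _)%E](_ : _ = 0%E) ?add0e.
Qed.

(** Lists, rather than the families over ['I_n] of [abs_continuous], because two of them over
    adjacent segments are joined by concatenation, as the transitivity in [segment_additive_ind]
    demands. *)
Definition itvs_in (a b : R) (s : seq (R * R)) :=
  all (fun p => [&& a <= p.1, p.1 <= p.2 & p.2 <= b]) s &&
  pairwise (fun p p' => p.2 <= p'.1) s.

Lemma itvs_in_cat a b c s s' : a <= b -> b <= c ->
  itvs_in a b s -> itvs_in b c s' -> itvs_in a c (s ++ s').
Proof.
move=> ab bc /andP[/allP As Ps] /andP[/allP As' Ps'].
apply/andP; split.
  rewrite all_cat; apply/andP; split; apply/allP => p.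
    by move=> /As/and3P[h1 h2 h3]; apply/and3P; split => //; lra.
  by move=> /As'/and3P[h1 h2 h3]; apply/and3P; split => //; lra.
rewrite pairwise_cat Ps Ps' !andbT; apply/allrelP => p p' /As/and3P[_ _ h1].
by move=> /As'/and3P[h2 _ _]; lra.
Qed.

Lemma abs_continuous_itvs (g : R -> R) : abs_continuous g ->
  forall e : R, 0 < e -> exists2 d : R, 0 < d & forall s, itvs_in 0 1 s ->
    \sum_(p <- s) (p.2 - p.1) < d -> \sum_(p <- s) `|g p.2 - g p.1| < e.
Proof.
move=> acg e e0; have [d d0 Hd] := acg _ e0; exists d => // s.
move=> /andP[/allP As /pairwiseP Ps].
rewrite !(big_nth (0, 0)) !big_mkord => sd.
apply: (Hd (size s) (fun i => (nth (0, 0) s i).1) (fun i => (nth (0, 0) s i).2)) => //.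
  by move=> i; have /and3P[] := As _ (mem_nth (0,0) (ltn_ord i)).
apply/trivIsetP => i j _ _ ij.
wlog ltij : i j ij / (i < j)%N.
  move=> W; have [ltij|ltji|/ord_inj eqij] := ltngtP i j.
  - exact: W.
  - by rewrite setIC; apply: W => //; rewrite eq_sym.
  - by rewrite eqij eqxx in ij.
have := Ps (0,0) i j (ltn_ord i) (ltn_ord j) ltij => h.
apply/seteqP; split => x //=; rewrite !in_itv/= => -[/andP[_ h1] /andP[h2 _]].
by lra.
Qed.

(* Small intervals around the points where [0 <= g'] decrease [g] by at most [e]
   times their length; the other points are covered by intervals contained in an
   open set [U] of small measure, on which [g] varies little in total. *)
Lemma abs_continuous_ge0_derive1_le (g : R -> R) : abs_continuous g ->
  {ae mu, forall t : R, I01 R t -> derivable g t 1 /\ 0 <= derive1 g t} ->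
  forall c d, 0 <= c -> c <= d -> d <= 1 -> g c <= g d.
Proof.
move=> acg aeg c d c0 cd d1.
apply/ler_addgt0Pr => eta eta0.
have [de de0 Hde] := abs_continuous_itvs _ acg _ (divr_gt0 eta0 (ltr0Sn R 1)).
have [U [oU EU Ude]] := null_open_cover _ _ aeg de0.
have mU : measurable U by exact: open_measurable.
pose e := eta / 2.
have e0 : 0 < e by rewrite divr_gt0.
(* The half-open []a, b]] makes the measures over adjacent segments add up exactly. The list [s]
   holds the segments around points of [U]; the increments elsewhere are paid for by
   [e * (b - a)]. *)
pose P a b := [/\ a <= b & exists s, [/\ itvs_in a b s,
   ((\sum_(p <- s) (p.2 - p.1))%:E <= mu (U `&` `]a, b]))%E &
    - (e * (b - a)) - \sum_(p <- s) `|g p.2 - g p.1| <= g b - g a]].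
have [_ [s [sin sU gs]]] : P c d.
  apply: segment_additive_ind => //.
  - move=> x y z [xy [s [sin sU gs]]] [yz [s' [sin' sU' gs']]].
    split; first exact: le_trans yz.
    exists (s ++ s'); split; first exact: itvs_in_cat sin'.
      rewrite big_cat/= EFinD.
      have -> : U `&` `]x, z] = (U `&` `]x, y]) `|` (U `&` `]y, z]).
        rewrite -setIUr; congr (_ `&` _); apply/seteqP; split => t /=; rewrite !in_itv/=.
          move=> /andP[h1 h2]; have [h|h] := leP t y; [left|right]; lra.
        by move=> [] /andP[h1 h2]; lra.
      rewrite measureU ?leeD//; [exact: measurableI|exact: measurableI|].
      apply/seteqP; split => t //= [[_ h1] [_ h2]]; move: h1 h2; rewrite !in_itv/=.
      by lra.
    by rewrite big_cat/=; lra.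
  - move=> s /andP[cs sd].
    have [Us|nUs] := pselect (U s).
      have /nbhs_ballP[r /= r0 rU] : nbhs s U by exact: open_nbhs_nbhs.
      exists r => // x y /andP[cx xs] /andP[sy yd] srx ysr.
      have xy : x <= y by exact: le_trans sy.
      split => //; exists [:: (x, y)]; split => /=.
      + by rewrite /itvs_in/= !lexx xy.
      + rewrite big_seq1/= setIidr; last first.
          move=> t /=; rewrite in_itv/= => /andP[xt ty]; apply: rU.
          by rewrite /ball/= ltr_distlC; lra.
        by rewrite [mu _]lebesgue_measure_itv/= lte_fin; case: ltP => //; rewrite lee_fin; lra.
      + rewrite big_seq1/=; have := ler_norm (- (g y - g x)); rewrite normrN.
        have : 0 <= e * (y - x) by rewrite mulr_ge0 ?subr_ge0// ltW.
        by lra.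
    have [] : derivable g s 1 /\ 0 <= derive1 g s.
      apply: contrapT => h; apply: nUs; apply: EU => /= h'; apply: h; apply: h'.
      by rewrite /I01/= in_itv/=; lra.
    move=> dg gs0; have [r r0 Hr] := derive1_approx _ _ _ _ dg e0.
    exists r => // x y /andP[cx xs] /andP[sy yd] srx ysr.
    have xy : x <= y by exact: le_trans sy.
    split => //; exists [::]; split => //.
      by rewrite big_nil measure_ge0.
    rewrite big_nil subr0.
    have := Hr x; have := Hr y.
    have -> : `|x - s| = s - x by rewrite distrC ger0_norm// subr_ge0.
    have -> : `|y - s| = y - s by rewrite ger0_norm// subr_ge0.
    move=> /(_ ltac:(lra)) + /(_ ltac:(lra)).
    rewrite !ler_norml => /andP[h1 _] /andP[_ h2].
    have h3 : 0 <= derive1 g s * (y - s) by rewrite mulr_ge0// subr_ge0.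
    have h4 : 0 <= derive1 g s * (s - x) by rewrite mulr_ge0// subr_ge0.
    by lra.
have : \sum_(p <- s) `|g p.2 - g p.1| < eta / 2.
  apply: Hde.
    move: sin => /andP[/allP As Ps]; apply/andP; split => //; apply/allP => p /As.
    by move=> /and3P[h1 h2 h3]; apply/and3P; split => //; lra.
  rewrite -lte_fin; apply: le_lt_trans Ude; apply: le_trans sU _.
  by apply: le_measure; rewrite ?inE//; exact: measurableI.
have : e * (d - c) <= e by rewrite ler_piMr ?(ltW e0)//; lra.
have : e = eta / 2 by [].
by move: gs; clearbody e; lra.
Qed.

Lemma Gamma_tilde_le (g : R -> R) : Gamma_tilde g ->
  forall c d, 0 <= c -> c <= d -> d <= 1 -> g c <= g d.
Proof. by move=> [_ acg _ _ aeg]; exact: abs_continuous_ge0_derive1_le. Qed.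

(** If [g c = g d], monotonicity makes [g] constant on [[c, d]]; but []c, d[] has positive measure,
    so it contains a point where [g' > 0], and [g] grows just to the right of it. *)
Lemma Gamma_lt (g : R -> R) : Gamma g ->
  forall c d, 0 <= c -> c < d -> d <= 1 -> g c < g d.
Proof.
move=> [Gg aeg] c d c0 cd d1.
have gle := Gamma_tilde_le _ Gg.
rewrite lt_neqAle gle ?(ltW cd)// andbT; apply/eqP => gcd.
have gx x : c <= x <= d -> g x = g c.
  move=> /andP[cx xd]; apply/eqP; rewrite eq_le.
  have := gle x d; have := gle c x; rewrite gcd => h1 h2.
  by rewrite h1 ?h2//; lra.
have [t [/= ht Ht]] : `]c, d[%classic `&`
   [set t | I01 R t -> derivable g t 1 /\ 0 < derive1 g t] !=set0.
  apply/set0P/negP => /eqP h.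
  have /(measure_negligible _) : mu.-negligible `]c, d[%classic.
    apply: negligibleS aeg => t tcd /= H.
    by have : set0 t by rewrite -h.
  move=> /(_ (measurable_itv _)); rewrite [LHS]lebesgue_measure_itv/= lte_fin cd.
  by move=> /eqP; rewrite eqe; lra.
move: ht; rewrite in_itv/= => /andP[ct td].
have [|dg dg0] := Ht; first by rewrite /I01/= in_itv/=; lra.
have [r r0 Hr] := derive1_approx _ _ _ _ dg (divr_gt0 dg0 (ltr0Sn R 1)).
pose x := Num.min d (t + r / 2).
have tx : t < x by rewrite lt_min td/=; lra.
have xd : x <= d by rewrite ge_min lexx.
have xr : x <= t + r / 2 by rewrite ge_min lexx orbT.
have := Hr x; rewrite ger0_norm ?subr_ge0 ?(ltW tx)// => /(_ ltac:(lra)).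
rewrite (gx x) ?(gx t); [|lra..].
rewrite subrr sub0r normrN ger0_norm; last by rewrite mulr_ge0 ?(ltW dg0)//; lra.
by rewrite ler_pM2r ?subr_gt0//; lra.
Qed.

End monotone.

(** * The integral of the derivative *)

Section increments.
Variable R : realType.
Local Notation mu := (@lebesgue_measure R).

Lemma continuous_primitive (G : R -> R) (a b : R) : a < b -> continuous G ->
  exists F : R -> R, forall x, a < x < b -> is_derive x 1 F (G x).
Proof.
move=> ab cG.
exists (fun x => \int[mu]_(t in `[a, x]) G t)%R => x /andP[ax xb].
have [|dF F'E] := @continuous_FTC1_closed R G a x b xb _ ax (cG x).
  apply: continuous_compact_integrable; first exact: segment_compact.
  exact: continuous_subspaceT.
by split; [exact: dF|rewrite -derive1E F'E].
Qed.

Lemma continuous_comp_shift (G : R -> R) (h : R) :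
  continuous G -> continuous (fun t => G (t + h)).
Proof.
move=> cG x; apply: (@continuous_comp _ _ _ (fun t => t + h) G); last exact: cG.
by apply: cvgD; [exact: cvg_id|exact: cvg_cst].
Qed.

(** With [F' = G], the function [F (t + h) - F t] is a primitive of the integrand. By the mean value
    theorem and monotonicity, it is at most [h * G (d + h)] at [d] and at least [h * G c] at [c]. *)
Lemma integral_increment_le (G : R -> R) (c d h : R) : continuous G ->
  (forall x y, x <= y -> G x <= G y) -> c <= d -> 0 < h ->
  (\int[mu]_(t in `[c, d]) (G (t + h)%R - G t)%:E <= (h * (G (d + h) - G c))%:E)%E.
Proof.
move=> cG ndG cd h0.
have [<-|] := eqVneq c d.
  rewrite set_itv1 integral_set1 lee_fin mulr_ge0 ?(ltW h0)//.
  by rewrite subr_ge0 ndG//; lra.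
move=> cd'; have {cd'}{}cd : c < d by rewrite lt_neqAle cd'.
(* The margins of 1 keep [t] and [t + h] interior to the domain of the primitive for [t] in a
   neighbourhood of [[c, d]]. *)
have [|F dF] := @continuous_primitive G (c - 1) (d + h + 1) _ cG; first lra.
have dFh x : c - 1 < x < d + 1 ->
    is_derive x 1 (fun y => F (y + h) - F y) (G (x + h) - G x).
  move=> xcd.
  have := dF x _; rewrite -?(andbA); have := dF (x + h) => dF1 dF2.
  have {}dF1 : is_derive (x + h) 1 F (G (x + h)) by apply: dF1; lra.
  have {}dF2 : is_derive x 1 F (G x) by apply: dF2; lra.
  have dFs := @is_derive1_comp _ F (shift h) x _ _ dF1 (is_derive_shift x 1 h).
  have := is_deriveB dFs dF2.
  by rewrite mulr1.
have cdFh x : c - 1 < x < d + 1 -> {for x, continuous (fun y => F (y + h) - F y)}.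
  move=> /dFh dx; apply: differentiable_continuous; apply/derivable1_diffP.
  exact: (@ex_derive _ _ _ _ _ _ _ dx).
have cF x : c - 1 < x < d + h + 1 -> {for x, continuous F}.
  move=> /dF dx; apply: differentiable_continuous; apply/derivable1_diffP.
  exact: (@ex_derive _ _ _ _ _ _ _ dx).
rewrite (@continuous_FTC2 _ (fun t => G (t + h) - G t) (fun y => F (y + h) - F y))//.
- rewrite -EFinB lee_fin.
  have mvt x : c - 1 < x -> x < d + 1 ->
      h * G x <= F (x + h) - F x <= h * G (x + h).
    move=> x1 x2; have xh : x < x + h by lra.
    have [| |y] := @MVT _ F G x (x + h) xh.
    + by move=> y; rewrite in_itv/= => ?; apply: dF; lra.
    + apply: derivable_within_continuous => y; rewrite in_itv/= => ?.
      have dy : is_derive y 1 F (G y) by apply: dF; lra.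
      exact: (@ex_derive _ _ _ _ _ _ _ dy).
    + rewrite in_itv/= => /andP[xy yxh] ->; rewrite (_ : x + h - x = h); last by ring.
      by rewrite mulrC (mulrC h) !ler_pM2r// !ndG// ltW.
  have /andP[_ h1] : h * G d <= F (d + h) - F d <= h * G (d + h) by apply: mvt; lra.
  have /andP[h2 _] : h * G c <= F (c + h) - F c <= h * G (c + h) by apply: mvt; lra.
  by rewrite mulrBr; lra.
- apply: continuous_subspaceT => x; apply: cvgB; last exact: cG.
  exact: continuous_comp_shift.
- split.
  + move=> x; rewrite in_itv/= => ?.
    have dx := dFh x ltac:(lra).
    exact: (@ex_derive _ _ _ _ _ _ _ dx).
  + by apply: cvg_at_right_filter; apply: cdFh; lra.
  + by apply: cvg_at_left_filter; apply: cdFh; lra.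
- move=> x; rewrite in_itv/= => ?.
  have dx := dFh x ltac:(lra).
  by rewrite derive1E; exact: derive_val.
Qed.

End increments.

Section density.
Variable R : realType.
Local Notation mu := (@lebesgue_measure R).

(** Composing with it extends a function on I continuously and monotonically to the line, so that
    difference quotients may look beyond 1. It also serves as the unit ramp in [pl]. *)
Definition clamp01 (t : R) : R := Num.max 0 (Num.min t 1).

Lemma clamp01_itv t : 0 <= clamp01 t <= 1.
Proof. by rewrite /clamp01 le_max lexx/= ge_max ler01 ge_min lexx orbT. Qed.

Lemma clamp01_id t : 0 <= t <= 1 -> clamp01 t = t.
Proof.
by move=> /andP[t0 t1]; rewrite /clamp01 min_l//; exact: max_r.
Qed.

Lemma clamp01_le s t : s <= t -> clamp01 s <= clamp01 t.
Proof.
move=> st; rewrite /clamp01 /Num.max /Num.min.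
by do ! case: ifPn; rewrite -?leNgt; lra.
Qed.

Lemma clamp01_dist s t : `|clamp01 s - clamp01 t| <= `|s - t|.
Proof.
wlog st : s t / t <= s.
  by move=> W; have [/W//|/ltW/W] := leP t s; rewrite distrC (distrC t).
rewrite !ger0_norm ?subr_ge0 ?clamp01_le// /clamp01 /Num.max /Num.min.
by do ! case: ifPn; rewrite -?leNgt; lra.
Qed.

Lemma abs_continuous_dist (g : R -> R) : abs_continuous g -> forall e : R, 0 < e ->
  exists2 d, 0 < d & forall a b, 0 <= a <= 1 -> 0 <= b <= 1 -> `|b - a| < d ->
    `|g b - g a| < e.
Proof.
move=> acg e e0; have [d d0 Hd] := acg e e0; exists d => // a b a01 b01.
wlog ab : a b a01 b01 / a <= b.
  move=> W; have [ab|/ltW ba] := leP a b; first exact: W.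
  by rewrite (distrC b) (distrC (g b)); exact: W.
rewrite ger0_norm ?subr_ge0// => abd.
have := Hd 1%N (fun=> a) (fun=> b).
rewrite !big_ord_recl !big_ord0 !addr0; apply => //; first by move=> _; lra.
by apply/trivIsetP => i j _ _; rewrite !ord1 eqxx.
Qed.

Lemma clamp01_comp_continuous (g : R -> R) :
  abs_continuous g -> continuous (g \o clamp01).
Proof.
move=> acg x; apply/cvgrPdist_lt => e e0.
have [d d0 Hd] := abs_continuous_dist _ acg e e0.
near=> y; apply: Hd; rewrite ?clamp01_itv//.
apply: (le_lt_trans (clamp01_dist _ _)).
by near: y; exact: cvgr_dist_lt.
Unshelve. all: by end_near. Qed.

Lemma clamp01_comp_le (g : R -> R) : Gamma_tilde g ->
  forall x y, x <= y -> (g \o clamp01) x <= (g \o clamp01) y.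
Proof.
move=> Gg x y xy /=; have /andP[h1 h2] := clamp01_itv x.
have /andP[h3 h4] := clamp01_itv y.
by apply: Gamma_tilde_le => //; exact: clamp01_le.
Qed.

Variables (g : R -> R) (G : set R).
Hypotheses (Gg : Gamma_tilde g) (mG : measurable G) (G01 : G `<=` `]0, 1[)
  (dG : forall t, G t -> derivable g t 1 /\ 0 <= derive1 g t).

Let quot (n : nat) (t : R) : R :=
  n.+1%:R * ((g \o clamp01) (t + n.+1%:R^-1) - (g \o clamp01) t).

Let quot_ge0 n t : 0 <= quot n t.
Proof.
rewrite mulr_ge0// subr_ge0; apply: clamp01_comp_le => //.
by rewrite lerDl invr_ge0.
Qed.

Let quot_meas n : measurable_fun setT (quot n).
Proof.
have cg : continuous (g \o clamp01).
  by apply: clamp01_comp_continuous; case: Gg.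
apply: continuous_measurable_fun => x.
apply: cvgM; first exact: cvg_cst.
apply: cvgB; last exact: cg.
exact: (@continuous_comp_shift _ (g \o clamp01)).
Qed.

Let quot_cvg t : G t -> quot ^~ t @ \oo --> derive1 g t.
Proof.
move=> Gt; have [dg _] := dG _ Gt.
have := G01 _ Gt; rewrite /= in_itv/= => /andP[t0 t1].
apply/cvgrPdist_le => e e0.
have [d d0 Hd] := derive1_approx _ _ _ _ dg e0.
have md : 0 < Num.min d (1 - t) by rewrite lt_min d0 subr_gt0.
near=> n.
have : n.+1%:R^-1 < Num.min d (1 - t).
  by near: n; exact: (near_infty_natSinv_lt (PosNum md)).
have : (0 : R) < n.+1%:R^-1 by rewrite invr_gt0.
rewrite /quot/= -[X in X * _]invrK.
move: (n.+1%:R^-1) => h h0; rewrite lt_min => /andP[hd ht].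
rewrite !clamp01_id; [|lra..].
have := Hd (t + h); rewrite (_ : t + h - t = h); last by ring.
rewrite gtr0_norm// => /(_ hd).
rewrite (_ : derive1 g t - _ = - (h^-1 * (g (t + h) - g t - derive1 g t * h))).
  rewrite normrN normrM normfV (gtr0_norm h0).
  by rewrite ler_pdivrMl// (mulrC h e).
by field; rewrite gt_eqF.
Unshelve. all: by end_near. Qed.

Let quotG_cvg t : (quot n \_ G) t @[n --> \oo] --> (derive1 g \_ G) t.
Proof.
rewrite patchE; case: ifPn => [/set_mem Gt|nGt].
  by under eq_fun do rewrite patchE mem_set//; exact: quot_cvg.
by under eq_fun do rewrite patchE (negbTE nGt); exact: cvg_cst.
Qed.

Let quotG_meas n : measurable_fun setT (quot n \_ G).
Proof. by apply/measurable_restrict => //; rewrite setTI; exact: measurable_funTS. Qed.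

(** The quotients [quot n] are continuous, and on [G] they converge pointwise to the derivative. *)
Lemma density_measurable : measurable_fun setT (derive1 g \_ G).
Proof. by apply: (@measurable_fun_cvg _ _ _ _ (fun n => quot n \_ G)). Qed.

Lemma density_ge0 t : 0 <= (derive1 g \_ G) t.
Proof. by rewrite patchE; case: ifPn => // /set_mem /dG[]. Qed.

(** Fatou's lemma for the difference quotients: by [integral_increment_le] the integral of the k-th
    one is at most [g (d + 1 / k.+1) - g c] (with [g] clamped), which tends to [g d - g c] by
    continuity. Restricting them to [G] only lowers the integrals. *)
Lemma density_integral_le c d : 0 <= c -> c <= d -> d <= 1 ->
  (\int[mu]_(t in `[c, d]) ((derive1 g \_ G) t)%:E <= (g d - g c)%:E)%E.
Proof.
move=> c0 cd d1.
have mf n : measurable_fun `[c, d] (fun t => ((quot n \_ G) t)%:E).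
  by apply/measurable_EFinP; exact: measurable_funTS.
have f0 n t : `[c, d]%classic t -> (0 <= ((quot n \_ G) t)%:E)%E.
  by move=> _; rewrite lee_fin patchE; case: ifPn.
have cg : continuous (g \o clamp01).
  by apply: clamp01_comp_continuous; case: Gg.
have <- : (\int[mu]_(t in `[c, d]) limn_einf (fun n => ((quot n \_ G) t)%:E) =
           \int[mu]_(t in `[c, d]) ((derive1 g \_ G) t)%:E)%E.
  apply: eq_integral => t _; apply: (cvg_limn_einf_sup _).1.
  by apply: cvg_EFin; [exact: nearW|exact: quotG_cvg].
apply: (le_trans (@fatou _ _ R mu `[c, d]%classic (measurable_itv _) _ mf f0)).
have cvgr : (((g \o clamp01) (d + n.+1%:R^-1) - g c)%:E)%E @[n --> \oo] -->
    (((g \o clamp01) d - g c)%:E)%E.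
  apply: cvg_EFin; first exact: nearW.
  apply: cvgB; last exact: cvg_cst.
  have : (fun n => d + n.+1%:R^-1) @ \oo --> d.
    rewrite -[X in _ --> X]addr0; apply: cvgD; first exact: cvg_cst.
    exact: cvg_harmonic.
  by move=> /(@cvg_comp _ _ _ _ (g \o clamp01) _ _ _); apply; exact: cg.
have <- : (g \o clamp01) d = g d by rewrite /= clamp01_id//; lra.
rewrite -(cvg_limn_einf_sup cvgr).1 !limn_einf_lim.
apply: lee_lim; [exact: is_cvg_einfs|exact: is_cvg_einfs|].
apply: nearW => n; apply: le_ereal_inf_tmp => _ /= [k nk <-].
apply: (le_trans (ereal_inf_lbound _ )); first by exists k.
apply: (@le_trans _ _ (\int[mu]_(t in `[c, d]) (quot k t)%:E)%E).
  apply: ge0_le_integral => //.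
  - by move=> t tcd; exact: (f0 k t tcd).
  - exact: (mf k).
  - by apply/measurable_EFinP; exact: (measurable_funTS (quot_meas k)).
  - by move=> t _; rewrite lee_fin patchE; case: ifPn.
have -> : (\int[mu]_(t in `[c, d]) (quot k t)%:E = \int[mu]_(t in `[c, d])
    (k.+1%:R%:E * ((g \o clamp01) (t + k.+1%:R^-1) - (g \o clamp01) t)%:E))%E.
  by apply: eq_integral => t _; rewrite -EFinM.
have mquot : measurable_fun setT (fun t : R =>
   (((g \o clamp01) (t + k.+1%:R^-1) - (g \o clamp01) t)%:E)).
  apply/measurable_EFinP.
  rewrite (_ : (fun _ => _) = (fun t => k.+1%:R^-1 * quot k t)).
    by apply: measurable_funM => //; exact: measurable_cst.
  by apply/funext => t; rewrite /quot mulrA mulVf ?mul1r// pnatr_eq0.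
rewrite ge0_integralZl//.
- have -> : g c = (g \o clamp01) c by rewrite /= clamp01_id//; lra.
  have := @integral_increment_le R (g \o clamp01) c d k.+1%:R^-1 cg (clamp01_comp_le _ Gg) cd.
  rewrite invr_gt0 => /(_ (ltr0Sn _ _)) h.
  apply: (le_trans (lee_pmul _ _ (lexx _) h)) => //.
    by apply: integral_ge0 => t _; rewrite lee_fin subr_ge0 clamp01_comp_le// lerDl invr_ge0.
  by rewrite -EFinM mulrA mulfV ?mul1r// pnatr_eq0.
- exact: measurable_funTS.
- by move=> t _; rewrite lee_fin subr_ge0 clamp01_comp_le// lerDl invr_ge0.
Qed.

End density.

(** * Integrals along a subdivision, and the AM-GM bound on one piece *)

Section integrals.
Variable R : realType.
Local Notation mu := (@lebesgue_measure R).

Lemma nondecreasing_upto (t : nat -> R) (n : nat) :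
  (forall k, (k < n)%N -> t k <= t k.+1) ->
  forall i j, (i <= j)%N -> (j <= n)%N -> t i <= t j.
Proof.
move=> tk i j ij; elim: j ij => [|j IH]; first by rewrite leqn0 => /eqP ->.
rewrite leq_eqVlt => /predU1P[->//|ij] jn.
by apply: le_trans (tk _ jn); apply: IH => //; exact: ltnW.
Qed.

(** Nodes may coincide, as they do along chains, and the pieces are open because step functions are
    known only there. *)
Lemma Rintegral_nodes (f : R -> R) (t : nat -> R) (n : nat) :
  (forall k, (k < n)%N -> t k <= t k.+1) ->
  mu.-integrable `[t 0%N, t n] (EFin \o f) ->
  (\int[mu]_(s in `[t 0%N, t n]) f s =
   \sum_(k < n) \int[mu]_(s in `]t k, t k.+1[) f s)%R.
Proof.
elim: n => [|n IH] tk fi; first by rewrite big_ord0 set_itv1 Rintegral_set1.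
have t0n : t 0%N <= t n by apply: (@nondecreasing_upto t n.+1).
have tn : t n <= t n.+1 by exact: tk.
rewrite big_ord_recr/= -IH; last 2 first.
- by move=> k kn; apply: tk; exact: ltnW.
- by apply: integrableS fi => //; apply: subset_itvl; rewrite bnd_simp.
have h := @Rintegral_itvB R f (BLeft (t 0%N)) (BRight (t n.+1)) (t n) fi.
rewrite Rintegral_itv_bndo_bndc.
  by rewrite -h ?bnd_simp// addrC subrK.
apply: integrableS fi => //.
by apply: subset_itv; rewrite bnd_simp.
Qed.

Lemma EFin_integrableZl (D : set R) (k : R) (f : R -> R) : measurable D ->
  mu.-integrable D (EFin \o f) -> mu.-integrable D (EFin \o (fun t => k * f t)).
Proof.
move=> mD fi; rewrite (_ : _ \o _ = (fun t => k%:E * (EFin \o f) t)%E).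
  exact: integrableZl.
by apply/funext => t /=; rewrite EFinM.
Qed.

Lemma EFin_integrableD (D : set R) (f g : R -> R) : measurable D ->
  mu.-integrable D (EFin \o f) -> mu.-integrable D (EFin \o g) ->
  mu.-integrable D (EFin \o (fun t => f t + g t)).
Proof.
move=> mD fi gi; rewrite (_ : _ \o _ = ((EFin \o f) \+ (EFin \o g))%E).
  exact: integrableD.
by apply/funext => t /=; rewrite EFinD.
Qed.

Lemma ge0_integrable_of_le (D : R -> R) (a b X : R) : (forall t, 0 <= D t) ->
  measurable_fun setT D -> (\int[mu]_(t in `[a, b]) (D t)%:E <= X%:E)%E ->
  mu.-integrable `[a, b] (EFin \o D).
Proof.
move=> D0 mD DX; apply/integrableP; split.
  by apply/measurable_EFinP; exact: measurable_funTS.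
under eq_integral do rewrite /= ger0_norm//.
exact: le_lt_trans DX (ltry _).
Qed.

(* The weights [e / c] and [c / e] of AM-GM, with [c = sqrt X] and [e = sqrt Y],
   make the bound sharp. *)
Lemma segment_integral_le (f D1 D2 : R -> R) (a b X Y W : R) :
  mu.-integrable `]a, b[ (EFin \o f) ->
  (forall t, 0 <= D1 t) -> (forall t, 0 <= D2 t) ->
  measurable_fun setT D1 -> measurable_fun setT D2 ->
  (\int[mu]_(t in `[a, b]) (D1 t)%:E <= X%:E)%E ->
  (\int[mu]_(t in `[a, b]) (D2 t)%:E <= Y%:E)%E ->
  0 < X -> 0 < Y -> 0 <= W ->
  (forall t, `]a, b[%classic t -> f t <= W * (Num.sqrt (D1 t) * Num.sqrt (D2 t))) ->
  (\int[mu]_(t in `]a, b[) f t <= W * Num.sqrt (X * Y))%R.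
Proof.
move=> fi D10 D20 mD1 mD2 D1X D2Y X0 Y0 W0 fle.
have sub : `]a, b[ `<=` `[a, b] by exact: subset_itv_oo_cc.
have iD1 : mu.-integrable `]a, b[ (EFin \o D1).
  by apply: integrableS (ge0_integrable_of_le _ _ _ _ D10 mD1 D1X).
have iD2 : mu.-integrable `]a, b[ (EFin \o D2).
  by apply: integrableS (ge0_integrable_of_le _ _ _ _ D20 mD2 D2Y).
have le_int (D : R -> R) Z : (forall t, 0 <= D t) -> measurable_fun setT D ->
    (\int[mu]_(t in `[a, b]) (D t)%:E <= Z%:E)%E ->
    (\int[mu]_(t in `]a, b[) D t <= Z)%R.
  move=> D0 mD DZ; rewrite -lee_fin /Rintegral fineK; last first.
    apply: integrable_fin_num => //.
    by apply: integrableS (ge0_integrable_of_le _ _ _ _ D0 mD DZ).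
  apply: le_trans DZ; apply: ge0_subset_integral => //.
  - by apply/measurable_EFinP; exact: measurable_funTS.
  - by move=> t _; rewrite lee_fin.
pose c := Num.sqrt X; pose e := Num.sqrt Y.
have c0 : 0 < c by rewrite sqrtr_gt0.
have e0 : 0 < e by rewrite sqrtr_gt0.
have iR : mu.-integrable `]a, b[ (EFin \o (fun t => W * ((e / c) / 2 * D1 t + (c / e) / 2 * D2 t))).
  by apply: EFin_integrableZl => //; apply: EFin_integrableD => //; exact: EFin_integrableZl.
apply: (@le_trans _ _ (\int[mu]_(t in `]a, b[) (W * ((e / c) / 2 * D1 t + (c / e) / 2 * D2 t)))%R).
  apply: le_Rintegral => // t abt; apply: le_trans (fle _ abt) _.
  apply: ler_wpM2l => //.
  have := D10 t; have := D20 t.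
  rewrite -[D1 t in X in _ -> _ -> X](sqr_sqrtr (D10 t)).
  rewrite -[D2 t in X in _ -> _ -> X](sqr_sqrtr (D20 t)).
  rewrite !(sqrtr_sqr, ger0_norm) ?sqrtr_ge0// => _ _.
  set u := Num.sqrt (D1 t); set v := Num.sqrt (D2 t).
  rewrite -subr_ge0.
  rewrite (_ : _ - _ = (e * u - c * v) ^+ 2 / (2 * c * e)).
    by rewrite divr_ge0 ?sqr_ge0// !mulr_ge0// ltW.
  by field; rewrite !gt_eqF.
rewrite RintegralZl//; last first.
  by apply: EFin_integrableD => //; exact: EFin_integrableZl.
apply: ler_wpM2l => //.
rewrite RintegralD//; [|exact: EFin_integrableZl..].
rewrite !RintegralZl// sqrtrM ?(ltW X0)// -/c -/e.
have h1 := le_int _ _ D10 mD1 D1X.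
have h2 := le_int _ _ D20 mD2 D2Y.
have -> : c * e = e / c / 2 * X + c / e / 2 * Y.
  rewrite -[X in e / c / 2 * X](sqr_sqrtr (ltW X0)) -/c.
  rewrite -[X in c / e / 2 * X](sqr_sqrtr (ltW Y0)) -/e.
  by field; rewrite !gt_eqF.
by apply: lerD; apply: ler_wpM2l => //; rewrite !divr_ge0// ltW.
Qed.

End integrals.

Section step_data.
Variable R : realType.

Lemma step_function_data (N : nat) (q : R -> 'rV[R]_N) : step_function q ->
  exists (n : nat) (S : nat -> R) (c : nat -> 'rV[R]_N),
  [/\ S 0%N = 0, S n = 1, forall i, (i < n)%N -> S i < S i.+1 &
      forall i, (i < n)%N -> forall t, S i < t < S i.+1 -> q t = c i].
Proof.
move=> [s sp sq].
have [c Hc] : {c : nat -> 'rV[R]_N & forall i, (i < size s)%N ->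
   forall t, nth 0 (0 :: s) i < t < nth 0 (0 :: s) i.+1 -> q t = c i}.
  apply: (@choice _ _ (fun i ci => (i < size s)%N ->
    forall t, nth 0 (0 :: s) i < t < nth 0 (0 :: s) i.+1 -> q t = ci)) => i.
  have [is_|] := ltnP i (size s); last by move=> h; exists 0; lia.
  have [ci Hci] := sq _ is_; exists ci => _ t tt; apply: Hci.
  by rewrite /= in_itv/=.
case: sp => /pathP sp /eqP sl.
exists (size s), (nth 0 (0 :: s)), c; split => //.
- by rewrite -sl (last_nth 0).
- by move=> i; exact: sp.
Qed.

End step_data.

(** * Chains of cells *)

Section cells.
Variable R : realType.
Local Notation mu := (@lebesgue_measure R).

(* For [k = i * m + j], the time [sigma j] clamped to [[tau i, tau i+1]]. *)
Definition lex_node (m : nat) (tau sigma : nat -> R) (k : nat) : R :=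
  Num.max (tau (k %/ m)%N) (Num.min (sigma (k %% m)%N) (tau (k %/ m).+1)).

(** The formula holds even when [k.+1] starts the next row: clamping [sigma 0 = 0] to
    [[tau i+1, tau i+2]] and clamping [sigma m = 1] to [[tau i, tau i+1]] both give [tau i+1]. For
    the last cell this involves [tau n.+1], which the bound on every [tau i] covers. *)
Lemma lex_nodeS (n m : nat) (tau sigma : nat -> R) (k : nat) :
  (forall i, 0 <= tau i <= 1) -> (k < n * m)%N ->
  (forall i, (i < n)%N -> tau i <= tau i.+1) ->
  sigma 0%N = 0 -> sigma m = 1 ->
  lex_node m tau sigma k.+1 =
  Num.max (tau (k %/ m)%N) (Num.min (sigma (k %% m).+1) (tau (k %/ m).+1)).
Proof.
move=> tau01 knm taule s0 sm.
have m0 : (0 < m)%N by case: m knm {sm} => //; rewrite muln0.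
have in_ : (k %/ m < n)%N by rewrite ltn_divLR.
have kE := divn_eq k m.
have [jm|mj] := ltnP (k %% m).+1 m.
  rewrite /lex_node.
  have -> : k.+1 = ((k %/ m) * m + (k %% m).+1)%N by lia.
  by rewrite divnMDl// modnMDl (divn_small jm) (modn_small jm) addn0.
have jm : ((k %% m).+1 = m)%N by apply/eqP; rewrite eqn_leq mj ltn_mod m0.
rewrite /lex_node jm sm.
have -> : k.+1 = ((k %/ m).+1 * m)%N by rewrite mulSn; lia.
rewrite mulnK// modnMl s0.
have /andP[h1 h2] := tau01 (k %/ m).+1.
have /andP[h3 h4] := tau01 (k %/ m).+2.
have h5 := taule _ in_.
by rewrite (min_l h3) (max_l h1) (min_r h2) (max_r h5).
Qed.

Lemma lex_node0 m tau sigma : tau 0%N = 0 -> sigma 0%N = 0 ->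
  (forall i, 0 <= tau i <= 1) -> lex_node m tau sigma 0 = 0.
Proof.
move=> t0 s0 tau01; rewrite /lex_node div0n mod0n t0 s0 min_l ?maxxx//.
by have /andP[] := tau01 1%N.
Qed.

Lemma lex_node_last n m tau sigma : (0 < m)%N -> tau n = 1 -> sigma 0%N = 0 ->
  lex_node m tau sigma (n * m) = 1.
Proof.
by move=> m0 tn s0; rewrite /lex_node mulnK// modnMl tn s0 max_l// ge_min ler01.
Qed.

(** The k-th step is the intersection of [[tau i, tau i+1]] and [[sigma j, sigma j+1]] when that has
    nonempty interior, and a single point otherwise. *)
Lemma lex_node_le (n m : nat) (tau sigma : nat -> R) (k : nat) :
  (forall i, 0 <= tau i <= 1) -> (k < n * m)%N ->
  (forall i, (i < n)%N -> tau i <= tau i.+1) ->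
  (forall j, (j < m)%N -> sigma j <= sigma j.+1) ->
  sigma 0%N = 0 -> sigma m = 1 ->
  lex_node m tau sigma k <= lex_node m tau sigma k.+1 /\
  (lex_node m tau sigma k < lex_node m tau sigma k.+1 ->
   [/\ tau (k %/ m)%N <= lex_node m tau sigma k,
       lex_node m tau sigma k.+1 <= tau (k %/ m).+1,
       sigma (k %% m)%N <= lex_node m tau sigma k &
       lex_node m tau sigma k.+1 <= sigma (k %% m).+1]).
Proof.
move=> tau01 knm taule sigmale s0 sm.
have m0 : (0 < m)%N by case: m knm {sm sigmale} => //; rewrite muln0.
rewrite (lex_nodeS n)// /lex_node.
have := sigmale _ (ltn_pmod k m0).
have : tau (k %/ m)%N <= tau (k %/ m).+1 by apply: taule; rewrite ltn_divLR.
move: (tau _) (tau _) (sigma _) (sigma _) => a b c d ab cd.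
rewrite /Num.max /Num.min.
by do ! case: ifPn; rewrite -?leNgt => *; split; try split; lra.
Qed.

(* A chain of points of the square whose consecutive ones either agree in one
   coordinate or lie in a common closed cell [S i, S i+1] x [T j, T j+1], the
   [n * m] cells being enumerated lexicographically. *)
Definition cell_chain (n m : nat) (S T x y : nat -> R) :=
  [/\ x 0%N = 0, y 0%N = 0, x (n * m)%N = 1, y (n * m)%N = 1 &
    forall k, (k < n * m)%N ->
    [/\ x k <= x k.+1, y k <= y k.+1 &
      [\/ x k = x k.+1, y k = y k.+1 |
        [/\ S (k %/ m)%N <= x k, x k.+1 <= S (k %/ m).+1,
            T (k %% m)%N <= y k & y k.+1 <= T (k %% m).+1]]]].

(** Preimages exist by the intermediate value theorem; strict monotonicity orders them and pins the
    extreme ones to 0 and 1. *)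
Lemma Gamma_preimages (g : R -> R) (n : nat) (S : nat -> R) : Gamma g ->
  S 0%N = 0 -> S n = 1 -> (forall i, (i < n)%N -> S i < S i.+1) ->
  exists tau : nat -> R, [/\ forall i, 0 <= tau i <= 1,
    tau 0%N = 0, tau n = 1,
    forall i, (i <= n)%N -> g (tau i) = S i &
    forall i, (i < n)%N -> tau i <= tau i.+1].
Proof.
move=> Gg S0 Sn SS.
have Sle i j : (i <= j)%N -> (j <= n)%N -> S i <= S j.
  by apply: nondecreasing_upto => k kn; exact/ltW/SS.
have [Gtg _] := Gg; have [gI acg g0 g1 _] := Gtg.
have glt := Gamma_lt _ _ Gg.
have [tau Htau] : {tau : nat -> R & forall i, 0 <= tau i <= 1 /\
    ((i <= n)%N -> g (tau i) = S i)}.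
  apply: (@choice _ _ (fun i (ti : R) => 0 <= ti <= 1 /\ ((i <= n)%N -> g ti = S i))) => i.
  (* Indices beyond [n] get the default 0, so that the bounds hold for every index. *)
  have [in_|] := leqP i n; last by move=> h; exists 0; split; [lra|lia].
  have cg : {within `[0, 1], continuous (g \o clamp01 R)}.
    by apply: continuous_subspaceT; exact: clamp01_comp_continuous.
  have [|t t01 gt] := IVT (v := S i) (@ler01 R) cg.
  - rewrite /= (@clamp01_id R 0) ?(@clamp01_id R 1) ?g0 ?g1 ?lexx ?ler01//.
    rewrite min_l ?max_r ?ler01//; have := Sle _ _ (leq0n i) in_.
    by have := Sle _ _ in_ (leqnn n); rewrite S0 Sn => -> ->.
  - move: t01; rewrite in_itv/= => t01; exists t; split => // _.
    by rewrite -gt/= clamp01_id.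
exists tau.
have tau01 i := (Htau i).1.
have gtau i := (Htau i).2.
split => //.
- have /andP[h1 h2] := tau01 0%N.
  apply/eqP; rewrite eq_le h1 andbT leNgt; apply/negP => h.
  have := glt _ _ (lexx 0) h h2.
  by rewrite g0 gtau// S0 ltxx.
- have /andP[h1 h2] := tau01 n.
  apply/eqP; rewrite eq_le h2/= leNgt; apply/negP => h.
  have := glt _ _ h1 h (lexx 1).
  by rewrite g1 gtau// Sn ltxx.
- move=> i in_; rewrite leNgt; apply/negP => h.
  have /andP[h1 _] := tau01 i.+1; have /andP[_ h2] := tau01 i.
  have := glt _ _ h1 h h2; rewrite !gtau ?(ltnW in_)//.
  by have := SS _ in_; lra.
Qed.

(** The times merge the preimages of the [S i] under [g1] with those of the [T j] under [g2]. A step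
    has positive duration only for a cell that the path crosses, hence the premise [t k < t k.+1] of
    the cell condition. *)
Lemma Gamma_chain (g1 g2 : R -> R) (n m : nat) (S T : nat -> R) :
  Gamma g1 -> Gamma g2 ->
  S 0%N = 0 -> S n = 1 -> (forall i, (i < n)%N -> S i < S i.+1) ->
  T 0%N = 0 -> T m = 1 -> (forall i, (i < m)%N -> T i < T i.+1) ->
  exists t : nat -> R, [/\ t 0%N = 0, t (n * m)%N = 1,
    forall k, (k < n * m)%N -> t k <= t k.+1 &
    forall k, (k < n * m)%N -> t k < t k.+1 ->
      [/\ S (k %/ m)%N <= g1 (t k), g1 (t k.+1) <= S (k %/ m).+1,
          T (k %% m)%N <= g2 (t k) & g2 (t k.+1) <= T (k %% m).+1]].
Proof.
move=> G1 G2 S0 Sn SS T0 Tm TT.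
have [tau [tau01 tau0 taun gtau taule]] := Gamma_preimages _ _ _ G1 S0 Sn SS.
have [sigma [sigma01 sigma0 sigmam gsigma sigmale]] := Gamma_preimages _ _ _ G2 T0 Tm TT.
have m0 : (0 < m)%N.
  by case: m Tm {TT sigmam gsigma sigmale} => //; rewrite T0; lra.
have tle k knm := @lex_node_le n m tau sigma k tau01 knm taule sigmale sigma0 sigmam.
exists (lex_node m tau sigma); split.
- exact: lex_node0.
- exact: lex_node_last.
- by move=> k knm; have [] := tle k knm.
- move=> k knm ltk; have [_ /(_ ltk)[h1 h2 h3 h4]] := tle k knm.
  have in_ : (k %/ m < n)%N by rewrite ltn_divLR.
  have jm : (k %% m < m)%N by rewrite ltn_mod.
  have g1le := Gamma_tilde_le _ _ G1.1.
  have g2le := Gamma_tilde_le _ _ G2.1.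
  have a1 := tau01 (k %/ m)%N; have a2 := tau01 (k %/ m).+1.
  have b1 := sigma01 (k %% m)%N; have b2 := sigma01 (k %% m).+1.
  rewrite -!gtau -?gsigma ?(ltnW in_) ?(ltnW jm)//.
  by split; [apply: g1le|apply: g1le|apply: g2le|apply: g2le]; lra.
Qed.

Lemma Gamma_cell_chain (g1 g2 : R -> R) (n m : nat) (S T t : nat -> R) :
  Gamma g1 -> Gamma g2 -> t 0%N = 0 -> t (n * m)%N = 1 ->
  (forall k, (k < n * m)%N -> t k <= t k.+1) ->
  (forall k, (k < n * m)%N -> t k < t k.+1 ->
    [/\ S (k %/ m)%N <= g1 (t k), g1 (t k.+1) <= S (k %/ m).+1,
        T (k %% m)%N <= g2 (t k) & g2 (t k.+1) <= T (k %% m).+1]) ->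
  cell_chain n m S T (g1 \o t) (g2 \o t).
Proof.
move=> G1 G2 t0 tL tle tcell.
have [[_ _ g10 g11 _] _] := G1; have [[_ _ g20 g21 _] _] := G2.
split; rewrite /= ?t0 ?tL// => k kL.
have h1 : 0 <= t k by rewrite -t0 (nondecreasing_upto _ _ _ tle)// ltnW.
have h2 : t k.+1 <= 1 by rewrite -tL (nondecreasing_upto _ _ _ tle).
have h3 := tle _ kL.
split; [exact: Gamma_tilde_le G1.1 _ _ _ _ _|exact: Gamma_tilde_le G2.1 _ _ _ _ _|].
move: h3; rewrite le_eqVlt => /predU1P[->|h3]; first by constructor 1.
by constructor 3; exact: tcell.
Qed.

(** One set for both reparametrizations, so that the two truncated actions can be multiplied. *)
Lemma Gamma_pair_good_set (g1 g2 : R -> R) : Gamma g1 -> Gamma g2 ->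
  exists G : set R, [/\ measurable G, G `<=` `]0, 1[, mu (I01 R `\` G) = 0%E &
    forall t, G t -> [/\ derivable g1 t 1, 0 < derive1 g1 t,
       derivable g2 t 1 & 0 < derive1 g2 t]].
Proof.
move=> [_ ae1] [_ ae2].
have [N1 [mN1 N10 sN1]] := ae1; have [N2 [mN2 N20 sN2]] := ae2.
have mI : measurable (I01 R) by exact: measurable_itv.
exists (`]0, 1[%classic `\` (N1 `|` N2)); split.
- by apply: measurableD => //; exact: measurableU.
- exact: subDsetl.
- apply/negligibleP.
    by apply: measurableD => //; apply: measurableD => //; exact: measurableU.
  have sub : I01 R `\` (`]0, 1[%classic `\` (N1 `|` N2)) `<=` [set (0 : R); 1] `|` (N1 `|` N2).
    move=> t [/= t01 nG]; have [|tn] := pselect ((N1 `|` N2) t); first by right.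
    left => /=; move: t01 nG; rewrite /I01/= in_itv/= => /andP[t0 t1] nG.
    have [->|tneq0] := eqVneq t 0; first by left.
    have [->|tneq1] := eqVneq t 1; first by right.
    exfalso; apply: nG; split => //; rewrite /= in_itv/= !lt_neqAle t0 t1 tneq1.
    by rewrite eq_sym tneq0.
  apply: negligibleS; first exact: sub.
  apply: negligibleU; last by apply: negligibleU; apply/negligibleP.
  have c2 : countable ([set (0 : R); 1]) by apply: finite_set_countable; exact: finite_set2.
  apply/negligibleP; last exact: (countable_lebesgue_measure0 c2).
  by apply: measurableU; exact: measurable_set1.
- move=> t [/= t01 nN].
  have It : I01 R t by exact: subset_itv_oo_cc.
  have [d1 p1] : derivable g1 t 1 /\ 0 < derive1 g1 t.
    by apply: contrapT => h; apply: nN; left; apply: sN1 => /= h'; apply: h; exact: h'.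
  have [d2 p2] : derivable g2 t 1 /\ 0 < derive1 g2 t.
    by apply: contrapT => h; apply: nN; right; apply: sN2 => /= h'; apply: h; exact: h'.
  by split.
Qed.

End cells.

(** * Inner products and their perturbation *)

Section dot.
Variable R : realType.
Local Notation mu := (@lebesgue_measure R).

Lemma dot_ge0 N (u : 'rV[R]_N) : 0 <= dot u u.
Proof. by apply: sumr_ge0 => i _; rewrite -expr2 sqr_ge0. Qed.

Lemma dot0 N : dot (0 : 'rV[R]_N) 0 = 0.
Proof. by rewrite /dot big1// => i _; rewrite !mxE mul0r. Qed.

Lemma dotZ N (a b : R) (u v : 'rV[R]_N) : dot (a *: u) (b *: v) = a * b * dot u v.
Proof. by rewrite /dot mulr_sumr; apply: eq_bigr => i _; rewrite !mxE; ring. Qed.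

(** In each coordinate [u v - a b = u (v - b) + v (u - a) - (u - a) (v - b)]. AM-GM is used with
    weight [d] on the first two products and weight 1 on the third; errors of norm at most [d] then
    cost only O(d). *)
Lemma dot_perturb N (d : R) (u v a b : 'rV[R]_N) : 0 < d ->
  dot u v <= dot a b + ((2 * d)^-1 + 2^-1) * dot (u - a) (u - a)
    + ((2 * d)^-1 + 2^-1) * dot (v - b) (v - b) + d / 2 * dot u u + d / 2 * dot v v.
Proof.
move=> d0; rewrite /dot !mulr_sumr -!big_split/=; apply: ler_sum => i _.
rewrite !mxE; move: (u 0 i) (v 0 i) (a 0 i) (b 0 i) => {}u {}v {}a {}b.
rewrite -subr_ge0.
have -> : a * b + ((2 * d)^-1 + 2^-1) * ((u - a) * (u - a))
    + ((2 * d)^-1 + 2^-1) * ((v - b) * (v - b)) + d / 2 * (u * u) + d / 2 * (v * v)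
    - u * v
  = (2 * d)^-1 * (((u - a) - d * v) ^+ 2 + ((v - b) - d * u) ^+ 2)
    + 2^-1 * ((u - a) + (v - b)) ^+ 2.
  by field; rewrite gt_eqF.
by rewrite addr_ge0// mulr_ge0 ?addr_ge0 ?sqr_ge0 ?invr_ge0// mulr_ge0// ltW.
Qed.

(** From [2 |a b| <= a^2 + b^2] and [a^2 <= 2 u^2 + 2 (u - a)^2], likewise for [b]. It dominates
    [dot a b] when only [u], [v] and the differences are known to be square-integrable. *)
Lemma dot_norm_le N (u v a b : 'rV[R]_N) :
  `|dot a b| <= dot u u + dot v v + dot (u - a) (u - a) + dot (v - b) (v - b).
Proof.
rewrite /dot -!big_split/=; apply: (le_trans (ler_norm_sum _ _ _)).
apply: ler_sum => i _; rewrite !mxE.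
move: (u 0 i) (v 0 i) (a 0 i) (b 0 i) => {}u {}v {}a {}b.
have h1 := sqr_ge0 (u + (u - a)); have h2 := sqr_ge0 (v + (v - b)).
have h3 := sqr_ge0 (a - b); have h4 := sqr_ge0 (a + b).
have h5 := sqr_ge0 (u - (u - a)); have h6 := sqr_ge0 (v - (v - b)).
have h7 := sqr_ge0 (u + u - a); have h8 := sqr_ge0 (v + v - b).
by rewrite ler_norml; apply/andP; split; nra.
Qed.

Lemma measurable_dot N (D : set R) (f g : R -> 'rV[R]_N) :
  (forall i, measurable_fun D (fun t => f t 0 i)) ->
  (forall i, measurable_fun D (fun t => g t 0 i)) ->
  measurable_fun D (fun t => dot (f t) (g t)).
Proof. by move=> mf mg; apply: measurable_sum => i; exact: measurable_funM. Qed.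

(* No measurability is needed, as the integral of a nonnegative function is the
   supremum of those of the simple functions below it; this matters because [act]
   need not be measurable. *)
Lemma ge0_integral_le (G I : set R) (h f : R -> \bar R) : G `<=` I ->
  (forall t, G t -> 0 <= h t)%E -> (forall t, I t -> 0 <= f t)%E ->
  (forall t, G t -> h t <= f t)%E ->
  (\int[mu]_(t in G) h t <= \int[mu]_(t in I) f t)%E.
Proof.
move=> GI h0 f0 hf; rewrite !ge0_integralE//.
apply: ereal_sup_le => _ /= [k kh <-]; exists k => //= t.
apply: (le_trans (kh t)); rewrite !patchE.
case: ifPn => [/set_mem Gt|_].
  by rewrite mem_set; [exact: hf|exact: GI].
by case: ifPn => // /set_mem/f0.
Qed.

Lemma sqrte_lt (x : \bar R) (e : R) : (0 <= x)%E -> (sqrte x < e%:E)%E ->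
  (x < (e ^+ 2)%:E)%E.
Proof.
case: x => [x||]//; rewrite lee_fin /= !lte_fin => x0 xe.
by rewrite -(sqr_sqrtr x0) ltr_sqr// ?nnegrE ?sqrtr_ge0// ltW// (le_lt_trans _ xe)// sqrtr_ge0.
Qed.

Lemma L2norm_lt N (f : R -> 'rV[R]_N) (e : R) : (L2norm f < e%:E)%E ->
  (\int[mu]_(t in I01 R) (dot (f t) (f t))%:E < (e ^+ 2)%:E)%E.
Proof.
by apply: sqrte_lt; apply: integral_ge0 => t _; rewrite lee_fin dot_ge0.
Qed.

Lemma L2norm_fin N (f : R -> 'rV[R]_N) : (L2norm f < +oo)%E ->
  (\int[mu]_(t in I01 R) (dot (f t) (f t))%:E < +oo)%E.
Proof.
by rewrite /L2norm; case: (integral _ _ _) => [x||]//=; rewrite ?ltry.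
Qed.

Lemma L2_integrable N (f : R -> 'rV[R]_N) : L2 f ->
  mu.-integrable (I01 R) (EFin \o (fun t => dot (f t) (f t))).
Proof.
move=> [mf /L2norm_fin fi]; apply/integrableP; split.
  by apply/measurable_EFinP; exact: measurable_dot.
apply: le_lt_trans fi; rewrite le_eqVlt; apply/orP; left; apply/eqP.
by apply: eq_integral => t _ /=; rewrite ger0_norm ?dot_ge0.
Qed.

Lemma dot_integrable N (D : set R) (f g : R -> 'rV[R]_N) : measurable D ->
  (forall i, measurable_fun D (fun t => f t 0 i)) ->
  (forall i, measurable_fun D (fun t => g t 0 i)) ->
  mu.-integrable D (EFin \o (fun t => dot (f t) (f t))) ->
  mu.-integrable D (EFin \o (fun t => dot (g t) (g t))) ->
  mu.-integrable D (EFin \o (fun t => dot (f t) (g t))).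
Proof.
move=> mD mf mg fi gi; apply: le_integrable (EFin_integrableD _ _ _ _ mD fi gi) => //.
  by apply/measurable_EFinP; exact: measurable_dot.
move=> t _ /=; rewrite lee_fin.
have := dot_norm_le N (f t) (g t) (f t) (g t).
by rewrite !subrr dot0 !addr0 => /le_trans; apply; exact: ler_norm.
Qed.

Lemma L2_dot_integrable N (f g : R -> 'rV[R]_N) : L2 f -> L2 g ->
  mu.-integrable (I01 R) (EFin \o (fun t => dot (f t) (g t))).
Proof.
move=> f2 g2; apply: dot_integrable; [exact: measurable_itv|exact: f2.1|exact: g2.1|..];
  exact: L2_integrable.
Qed.

Lemma Rintegral_null (D G : set R) (f : R -> R) : measurable D -> measurable G ->
  G `<=` D -> mu (D `\` G) = 0%E -> mu.-integrable D (EFin \o f) ->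
  (\int[mu]_(t in D) f t = \int[mu]_(t in G) f t)%R.
Proof.
move=> mD mG GD DG0 fi; rewrite /Rintegral.
rewrite (@negligible_integral _ _ _ mu D (D `\` G))//; last exact: measurableD.
by rewrite setDD setIidr.
Qed.

(** Continuity of the inner product near [(u, v)]. The error [d + d ^+ 2] is [2 * k * d ^+ 2], where
    [k = 1 / (2 d) + 1 / 2] is the coefficient in [dot_perturb]. *)
Lemma dot_integral_perturb N (G : set R) (d : R) (u v a b : R -> 'rV[R]_N) :
  measurable G -> 0 < d ->
  (forall i, measurable_fun G (fun t => u t 0 i)) ->
  (forall i, measurable_fun G (fun t => v t 0 i)) ->
  (forall i, measurable_fun G (fun t => a t 0 i)) ->
  (forall i, measurable_fun G (fun t => b t 0 i)) ->
  mu.-integrable G (EFin \o (fun t => dot (u t) (u t))) ->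
  mu.-integrable G (EFin \o (fun t => dot (v t) (v t))) ->
  (\int[mu]_(t in G) (dot (u t - a t) (u t - a t))%:E <= (d ^+ 2)%:E)%E ->
  (\int[mu]_(t in G) (dot (v t - b t) (v t - b t))%:E <= (d ^+ 2)%:E)%E ->
  mu.-integrable G (EFin \o (fun t => dot (a t) (b t))) /\
  (\int[mu]_(t in G) dot (u t) (v t) <= \int[mu]_(t in G) dot (a t) (b t) + d + d ^+ 2 +
    d / 2 * \int[mu]_(t in G) dot (u t) (u t) + d / 2 * \int[mu]_(t in G) dot (v t) (v t))%R.
Proof.
have arith (P A B c x y p q : R) : A <= c -> B <= c -> 2 * c = x + y ->
    P + A + B + p + q <= P + x + y + p + q by lra.
move=> mG d0 mu_ mv ma mb iu iv hu hv.
have mB (f g : R -> 'rV[R]_N) :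
    (forall i, measurable_fun G (fun t => f t 0 i)) ->
    (forall i, measurable_fun G (fun t => g t 0 i)) ->
    measurable_fun G (fun t => dot (f t - g t) (f t - g t)).
  move=> mf mg; apply: measurable_dot => i.
    rewrite (_ : (fun _ => _) = (fun t => f t 0 i - g t 0 i)).
      exact: measurable_funB.
    by apply/funext => t; rewrite !mxE.
  rewrite (_ : (fun _ => _) = (fun t => f t 0 i - g t 0 i)).
    exact: measurable_funB.
  by apply/funext => t; rewrite !mxE.
have iB (f g : R -> 'rV[R]_N) :
    (forall i, measurable_fun G (fun t => f t 0 i)) ->
    (forall i, measurable_fun G (fun t => g t 0 i)) ->
    (\int[mu]_(t in G) (dot (f t - g t) (f t - g t))%:E <= (d ^+ 2)%:E)%E ->
    mu.-integrable G (EFin \o (fun t => dot (f t - g t) (f t - g t))) /\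
    (\int[mu]_(t in G) dot (f t - g t) (f t - g t) <= d ^+ 2)%R.
  move=> mf mg h.
  have i : mu.-integrable G (EFin \o (fun t => dot (f t - g t) (f t - g t))).
    apply/integrableP; split; first by apply/measurable_EFinP; exact: mB.
    apply: le_lt_trans (ltry (d ^+ 2)); apply: le_trans h.
    rewrite le_eqVlt; apply/orP; left; apply/eqP.
    by apply: eq_integral => t _ /=; rewrite ger0_norm ?dot_ge0.
  by split => //; rewrite -lee_fin /Rintegral fineK//; exact: integrable_fin_num.
have [iua hua] := iB _ _ mu_ ma hu.
have [ivb hvb] := iB _ _ mv mb hv.
have isum : mu.-integrable G (EFin \o (fun t => dot (u t) (u t) + dot (v t) (v t) +
    dot (u t - a t) (u t - a t) + dot (v t - b t) (v t - b t))).
  by do 3 (apply: EFin_integrableD => //).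
have iab : mu.-integrable G (EFin \o (fun t => dot (a t) (b t))).
  apply: le_integrable isum => //; first by apply/measurable_EFinP; exact: measurable_dot.
  move=> t _ /=; rewrite lee_fin; apply: le_trans (ler_norm _).
  exact: dot_norm_le.
have iuv := dot_integrable _ _ _ _ mG mu_ mv iu iv.
split => //.
set k := (2 * d)^-1 + 2^-1.
have ik1 := EFin_integrableZl _ _ k _ mG iua.
have ik2 := EFin_integrableZl _ _ k _ mG ivb.
have ik3 := EFin_integrableZl _ _ (d / 2) _ mG iu.
have ik4 := EFin_integrableZl _ _ (d / 2) _ mG iv.
have i1 := EFin_integrableD _ _ _ _ mG iab ik1.
have i2 := EFin_integrableD _ _ _ _ mG i1 ik2.
have i3 := EFin_integrableD _ _ _ _ mG i2 ik3.
have i4 := EFin_integrableD _ _ _ _ mG i3 ik4.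
apply: (le_trans (@le_Rintegral _ _ _ mu G _ _ mG iuv i4 _)).
  by move=> t _; exact: dot_perturb.
rewrite !RintegralD// !RintegralZl//.
have k0 : 0 <= k by rewrite addr_ge0 ?invr_ge0// mulr_ge0// ltW.
apply: arith (ler_wpM2l k0 hua) (ler_wpM2l k0 hvb) _.
by rewrite /k; field; rewrite gt_eqF.
Qed.

End dot.

(** * The upper bound on orbit closures *)

Section upper_bound.
Variables (R : realType) (N : nat).
Local Notation mu := (@lebesgue_measure R).

Definition cell_weight (m : nat) (c d : nat -> 'rV[R]_N) (k : nat) : R :=
  dot (c (k %/ m)%N) (d (k %% m)%N).

Definition chain_value (n m : nat) (c d : nat -> 'rV[R]_N) (x y : nat -> R) : R :=
  \sum_(k < n * m) Num.max 0 (cell_weight m c d k) *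
    Num.sqrt ((x k.+1 - x k) * (y k.+1 - y k)).

(* A Borel version of [act q g]: [derive1 g] is only known to be measurable
   on a measurable set of points of derivability. *)
Definition act_on (G : set R) (q : R -> 'rV[R]_N) (g : R -> R) (t : R) :=
  Num.sqrt ((derive1 g \_ G) t) *: q (g t).

Lemma measurable_sqrt_comp (D : set R) (f : R -> R) :
  measurable_fun D f -> measurable_fun D (fun t => Num.sqrt (f t)).
Proof.
by move=> mf; apply: measurableT_comp mf; apply: continuous_measurable_fun; exact: sqrt_continuous.
Qed.

Lemma measurable_comp_I01 (h : R -> R) (g : R -> R) : Gamma_tilde g ->
  measurable_fun (I01 R) h -> measurable_fun (I01 R) (h \o g).
Proof.
move=> [gI acg _ _ _] mh.
apply: (@eq_measurable_fun _ _ _ _ _ (h \o (g \o clamp01 R))).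
  by move=> t /set_mem; rewrite /I01/= in_itv/= => t01; rewrite clamp01_id.
apply: (measurable_comp _ _ mh); first exact: measurable_itv.
  move=> _ [t It <-]; rewrite /= clamp01_id; first exact: gI.
  by move: It; rewrite /I01/= in_itv.
apply: measurable_funTS; apply: continuous_measurable_fun.
exact: clamp01_comp_continuous.
Qed.

Lemma act_on_measurable (G : set R) (q : R -> 'rV[R]_N) (g : R -> R) :
  Gamma_tilde g -> measurable G -> G `<=` `]0, 1[ ->
  (forall t, G t -> derivable g t 1 /\ 0 <= derive1 g t) ->
  (forall i, measurable_fun (I01 R) (fun t => q t 0 i)) ->
  forall i, measurable_fun (I01 R) (fun t => act_on G q g t 0 i).
Proof.
move=> Gg mG G01 dG mq i.
rewrite (_ : (fun _ => _) = (fun t => Num.sqrt ((derive1 g \_ G) t) * q (g t) 0 i)).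
  apply: measurable_funM.
    by apply: measurable_sqrt_comp; apply: measurable_funTS; exact: density_measurable.
  exact: (measurable_comp_I01 (fun s => q s 0 i)).
by apply/funext => t; rewrite mxE.
Qed.

Variables (q w : R -> 'rV[R]_N) (n m : nat) (S T : nat -> R) (c d : nat -> 'rV[R]_N).
Hypotheses (S0 : S 0%N = 0) (Sn : S n = 1) (SS : forall i, (i < n)%N -> S i < S i.+1)
  (Sq : forall i, (i < n)%N -> forall t, S i < t < S i.+1 -> q t = c i).
Hypotheses (T0 : T 0%N = 0) (Tm : T m = 1) (TT : forall i, (i < m)%N -> T i < T i.+1)
  (Tw : forall i, (i < m)%N -> forall t, T i < t < T i.+1 -> w t = d i).

Lemma path_integral_le (g1 g2 : R -> R) (G : set R) : Gamma g1 -> Gamma g2 ->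
  measurable G -> G `<=` `]0, 1[ ->
  (forall t, G t -> [/\ derivable g1 t 1, 0 < derive1 g1 t,
     derivable g2 t 1 & 0 < derive1 g2 t]) ->
  mu.-integrable (I01 R) (EFin \o (fun t => dot (act_on G q g1 t) (act_on G w g2 t))) ->
  exists x y, cell_chain R n m S T x y /\
    (\int[mu]_(t in I01 R) dot (act_on G q g1 t) (act_on G w g2 t) <=
     chain_value n m c d x y)%R.
Proof.
move=> G1 G2 mG G01 dG fi.
have [t [t0 tL tle tcell]] := Gamma_chain _ _ _ n m S T G1 G2 S0 Sn SS T0 Tm TT.
have g1lt := Gamma_lt _ _ G1; have g2lt := Gamma_lt _ _ G2.
have m0 : (0 < m)%N.
  rewrite lt0n; apply/eqP => m0; move: Tm; rewrite m0 T0; lra.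
have t01 k : (k <= n * m)%N -> 0 <= t k <= 1.
  move=> kL; rewrite -{1}t0 -tL.
  by rewrite !(nondecreasing_upto _ _ _ tle).
exists (g1 \o t), (g2 \o t); split; first exact: Gamma_cell_chain.
have d1 s : G s -> derivable g1 s 1 /\ 0 <= derive1 g1 s.
  by move=> /dG[h1 h2 _ _]; split => //; exact: ltW.
have d2 s : G s -> derivable g2 s 1 /\ 0 <= derive1 g2 s.
  by move=> /dG[_ _ h1 h2]; split => //; exact: ltW.
have IE : I01 R = `[t 0%N, t (n * m)%N]%classic by rewrite t0 tL.
rewrite IE Rintegral_nodes//; last by rewrite -IE.
apply: ler_sum => k _; have kL := ltn_ord k.
have /andP[h1 h2] := t01 _ (ltnW kL); have /andP[h3 h4] := t01 _ kL.
(* A step without duration contributes 0, and its term in [chain_value] is nonnegative because the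
   weights are cut off at 0. *)
have := tle _ kL; rewrite le_eqVlt => /predU1P[->|tk].
  rewrite set_itvoo0 Rintegral_set0 mulr_ge0 ?sqrtr_ge0//.
  by rewrite le_max lexx.
have [c1 c2 c3 c4] := tcell _ kL tk.
apply: (@segment_integral_le _ _ (derive1 g1 \_ G) (derive1 g2 \_ G)).
- apply: integrableS fi => //; first exact: measurable_itv.
  move=> s /=; rewrite /I01/= !in_itv/= => /andP[s1 s2].
  by apply/andP; split; [exact: le_trans h1 (ltW s1)|exact: le_trans (ltW s2) h4].
- exact: density_ge0.
- exact: density_ge0.
- by apply: density_measurable => //; exact: G1.1.
- by apply: density_measurable => //; exact: G2.1.
- by apply: density_integral_le => //; [exact: G1.1|exact: ltW].
- by apply: density_integral_le => //; [exact: G2.1|exact: ltW].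
- by rewrite subr_gt0 g1lt.
- by rewrite subr_gt0 g2lt.
- by rewrite le_max lexx.
- move=> s /=; rewrite in_itv/= => /andP[s1 s2].
  rewrite /act_on dotZ mulrC ler_wpM2r ?mulr_ge0 ?sqrtr_ge0//.
  have s0 : 0 <= s by exact: le_trans h1 (ltW s1).
  have s1' : s <= 1 by exact: le_trans (ltW s2) h4.
  (* Strict monotonicity puts [g1 s] and, below, [g2 s] strictly inside the cell, where [q] and [w]
     take the values [c i] and [d j]. *)
  rewrite (Sq (k %/ m)) ?ltn_divLR//; last first.
    apply/andP; split; first exact: le_lt_trans c1 (g1lt _ _ h1 s1 s1').
    exact: lt_le_trans (g1lt _ _ s0 s2 h4) c2.
  rewrite (Tw (k %% m)) ?ltn_mod//; last first.
    apply/andP; split; first exact: le_lt_trans c3 (g2lt _ _ h1 s1 s1').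
    exact: lt_le_trans (g2lt _ _ s0 s2 h4) c4.
  by rewrite le_max lexx orbT.
Qed.

Lemma act_on_error (u : R -> 'rV[R]_N) (v : R -> 'rV[R]_N) (g : R -> R) (G : set R) (e : R) :
  G `<=` I01 R -> (L2norm (fun t => (u t - act v g t)%R) < e%:E)%E ->
  (\int[mu]_(t in G) (dot (u t - act_on G v g t) (u t - act_on G v g t))%:E <=
    (e ^+ 2)%:E)%E.
Proof.
move=> GI /L2norm_lt/ltW; apply: le_trans.
apply: ge0_integral_le => //.
- by move=> t _; rewrite lee_fin dot_ge0.
- by move=> t _; rewrite lee_fin dot_ge0.
- by move=> t Gt; rewrite /act_on patchE mem_set.
Qed.

Lemma orbit_closure_inner_le (M : R) (qt wt : R -> 'rV[R]_N) :
  (forall i, measurable_fun (I01 R) (fun t => q t 0 i)) ->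
  (forall i, measurable_fun (I01 R) (fun t => w t 0 i)) ->
  (forall x y, cell_chain R n m S T x y -> chain_value n m c d x y <= M) ->
  orbit_closure q qt -> orbit_closure w wt -> L2inner qt wt <= M.
Proof.
move=> mq mw HM [L2q clq] [L2w clw].
have iq := L2_integrable _ _ _ L2q; have iw := L2_integrable _ _ _ L2w.
pose A := (\int[mu]_(t in I01 R) dot (qt t) (qt t))%R.
pose B := (\int[mu]_(t in I01 R) dot (wt t) (wt t))%R.
have A0 : 0 <= A by apply: Rintegral_ge0 => t _; exact: dot_ge0.
have B0 : 0 <= B by apply: Rintegral_ge0 => t _; exact: dot_ge0.
have mI : measurable (I01 R) by exact: measurable_itv.
apply/ler_addgt0Pr => eps eps0.
have K0 : 0 < 2 + A + B by rewrite -addrA ltr_wpDr// addr_ge0.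
(* For [e <= 1] the error [e + e^2 + e A / 2 + e B / 2] of [dot_integral_perturb] is at most
   [e (2 + A + B)]. *)
pose e := Num.min 1 (eps / (2 + A + B)).
have e0 : 0 < e by rewrite lt_min ltr01 divr_gt0.
have e1 : e <= 1 by rewrite ge_min lexx.
have eK : e * (2 + A + B) <= eps by rewrite -ler_pdivlMr// ge_min lexx orbT.
have [g1 G1 H1] := clq _ e0; have [g2 G2 H2] := clw _ e0.
have [G [mG G01 GN dG]] := Gamma_pair_good_set _ _ _ G1 G2.
have GI : G `<=` I01 R.
  by move=> t /G01; exact: subset_itv_oo_cc.
have d1 s : G s -> derivable g1 s 1 /\ 0 <= derive1 g1 s.
  by move=> /dG[h1 h2 _ _]; split => //; exact: ltW.
have d2 s : G s -> derivable g2 s 1 /\ 0 <= derive1 g2 s.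
  by move=> /dG[_ _ h1 h2]; split => //; exact: ltW.
have ma1 := act_on_measurable _ _ _ G1.1 mG G01 d1 mq.
have ma2 := act_on_measurable _ _ _ G2.1 mG G01 d2 mw.
have toG (f : R -> 'rV[R]_N) : (forall i, measurable_fun (I01 R) (fun t => f t 0 i)) ->
    forall i, measurable_fun G (fun t => f t 0 i).
  by move=> mf i; apply: (measurable_funS mI GI (mf i)).
have iqG : mu.-integrable G (EFin \o (fun t => dot (qt t) (qt t))).
  exact: integrableS iq.
have iwG : mu.-integrable G (EFin \o (fun t => dot (wt t) (wt t))).
  exact: integrableS iw.
have [iab] := dot_integral_perturb _ _ _ _ _ _ _ _ mG e0 (toG _ L2q.1) (toG _ L2w.1)
  (toG _ ma1) (toG _ ma2) iqG iwG (act_on_error _ _ _ _ _ GI H1) (act_on_error _ _ _ _ _ GI H2).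
have fG t : (I01 R) t -> ~ G t -> dot (act_on G q g1 t) (act_on G w g2 t) = 0.
  move=> _ nG; rewrite /act_on dotZ patchE ifF ?sqrtr0 ?mul0r//.
  by apply/negP => /set_mem.
(* The truncated actions vanish off [G], so integrability on [G] gives integrability on I. *)
have iI : mu.-integrable (I01 R)
    (EFin \o (fun t => dot (act_on G q g1 t) (act_on G w g2 t))).
  have : mu.-integrable (I01 R)
      ((EFin \o (fun t => dot (act_on G q g1 t) (act_on G w g2 t))) \_ G).
    by apply/integrable_restrict => //; rewrite setIidr.
  apply: eq_integrable => // t /set_mem It; rewrite patchE.
  case: ifPn => // nG; rewrite /= fG// => Gt; case/negP: nG; exact/mem_set.
have iuvI := L2_dot_integrable _ _ _ _ L2q L2w.
have [x [y [xy fle]]] := path_integral_le _ _ _ G1 G2 mG G01 dG iI.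
have {}fle := le_trans fle (HM _ _ xy).
rewrite /L2inner (Rintegral_null _ _ _ _ mI mG GI GN iuvI).
rewrite -!(Rintegral_null _ _ _ _ mI mG GI GN) // -/A -/B => h.
apply: (le_trans h).
have e2 : e ^+ 2 <= e by rewrite expr2 ler_piMr ?(ltW e0).
by move: fle e2 eK; rewrite !mulrDr; clearbody A B e; nra.
Qed.

End upper_bound.

(** * Existence of a maximal chain *)

Section closedness.
Variables (R : realType) (T : topologicalType).

Lemma closed_fun_le (f g : T -> R) : continuous f -> continuous g ->
  closed [set v | f v <= g v].
Proof.
move=> cf cg.
rewrite (_ : mkset _ = (fun v => g v - f v) @^-1` [set x | 0 <= x]).
  apply: preimage_closed; last exact: closed_ge.
  by move=> v _; apply: cvgB; [exact: cg|exact: cf].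
by apply/seteqP; split => v /=; rewrite subr_ge0.
Qed.

Lemma closed_fun_eq (f g : T -> R) : continuous f -> continuous g ->
  closed [set v | f v = g v].
Proof.
move=> cf cg.
rewrite (_ : mkset _ = [set v | f v <= g v] `&` [set v | g v <= f v]).
  by apply: closedI; exact: closed_fun_le.
apply/seteqP; split => v /=; first by move=> ->; rewrite lexx.
by move=> [h1 h2]; apply/eqP; rewrite eq_le h1 h2.
Qed.

End closedness.

Section chain_max.
Variables (R : realType) (N : nat) (n m : nat).
Variables (S T : nat -> R) (c d : nat -> 'rV[R]_N).

(** Equalities, non-strict inequalities and a disjunction of three closed alternatives: here the
    degenerate steps and closed cells in [cell_chain] pay off. *)
Lemma cell_chain_closed (V : topologicalType) (X Y : V -> nat -> R) :
  (forall k, continuous (X ^~ k)) -> (forall k, continuous (Y ^~ k)) ->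
  closed [set v | cell_chain R n m S T (X v) (Y v)].
Proof.
move=> cX cY.
have cst_cont a : continuous (fun _ : V => a : R) by exact: cst_continuous.
pose F k := [set v | X v k <= X v k.+1] `&` [set v | Y v k <= Y v k.+1] `&`
  ([set v | X v k = X v k.+1] `|` [set v | Y v k = Y v k.+1] `|`
   ([set v | S (k %/ m)%N <= X v k] `&` [set v | X v k.+1 <= S (k %/ m).+1] `&`
    [set v | T (k %% m)%N <= Y v k] `&` [set v | Y v k.+1 <= T (k %% m).+1])).
rewrite (_ : mkset _ = [set v | X v 0%N = 0] `&` [set v | Y v 0%N = 0] `&`
    [set v | X v (n * m)%N = 1] `&` [set v | Y v (n * m)%N = 1] `&`
    \bigcap_(k in [set k | (k < n * m)%N]) F k).
  apply: closedI; last first.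
    apply: closed_bigI => k _; apply: closedI.
      by apply: closedI; exact: closed_fun_le.
    apply: closedU; first by apply: closedU; exact: closed_fun_eq.
    by do ! apply: closedI; exact: closed_fun_le.
  by do ! apply: closedI; exact: closed_fun_eq.
apply/seteqP; split => v /=.
  move=> [h1 h2 h3 h4 h5]; split => // k /= /h5[a b e]; split => //.
  by case: e => [e|e|[e1 e2 e3 e4]]; [left; left|left; right|right].
move=> [[[[h1 h2] h3] h4] h5]; split => // k kL.
have [[a b] e] := h5 k kL; split => //.
by case: e => [[e|e]|[[[e1 e2] e3] e4]];
  [constructor 1|constructor 2|constructor 3].
Qed.

Lemma chain_value_continuous (V : topologicalType) (X Y : V -> nat -> R) :
  (forall k, continuous (X ^~ k)) -> (forall k, continuous (Y ^~ k)) ->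
  continuous (fun v => chain_value R N n m c d (X v) (Y v)).
Proof.
move=> cX cY v; apply: cvg_big => [x|k _]; first exact: add_continuous.
apply: cvgM; first exact: cvg_cst.
apply: (@continuous_comp _ _ _ (fun v => (X v k.+1 - X v k) * (Y v k.+1 - Y v k)) Num.sqrt).
  by apply: cvgM; apply: cvgB; first [exact: cX|exact: cY].
exact: sqrt_continuous.
Qed.

Lemma cell_chain_ext (x y x' y' : nat -> R) :
  (forall k, (k <= n * m)%N -> x k = x' k) -> (forall k, (k <= n * m)%N -> y k = y' k) ->
  cell_chain R n m S T x y -> cell_chain R n m S T x' y'.
Proof.
move=> ex ey [h1 h2 h3 h4 h5]; rewrite ex// in h1; rewrite ey// in h2.
rewrite ex// in h3; rewrite ey// in h4; split => // k kL.
by have := h5 _ kL; rewrite !ex ?(ltnW kL)// !ey ?(ltnW kL).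
Qed.

Lemma chain_value_ext (x y x' y' : nat -> R) :
  (forall k, (k <= n * m)%N -> x k = x' k) -> (forall k, (k <= n * m)%N -> y k = y' k) ->
  chain_value R N n m c d x y = chain_value R N n m c d x' y'.
Proof.
move=> ex ey; apply: eq_bigr => k _; have kL := ltn_ord k.
by rewrite !ex ?(ltnW kL)// !ey ?(ltnW kL).
Qed.

Lemma cell_chain_itv01 x y : cell_chain R n m S T x y -> forall k, (k <= n * m)%N ->
  0 <= x k <= 1 /\ 0 <= y k <= 1.
Proof.
move=> [x0 y0 x1 y1 xy] k kL.
have xle i : (i < n * m)%N -> x i <= x i.+1 by move=> /xy[].
have yle i : (i < n * m)%N -> y i <= y i.+1 by move=> /xy[].
have /(_ 0%N k) h1 := nondecreasing_upto _ _ _ xle.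
have /(_ k (n * m)%N) h2 := nondecreasing_upto _ _ _ xle.
have /(_ 0%N k) h3 := nondecreasing_upto _ _ _ yle.
have /(_ k (n * m)%N) h4 := nondecreasing_upto _ _ _ yle.
by rewrite -{1}x0 -{1}y0 h1// h3//= -x1 h2//= x1 -y1 h4.
Qed.

Lemma chain_value_max : (exists x y, cell_chain R n m S T x y) ->
  exists x y, cell_chain R n m S T x y /\
    forall x' y', cell_chain R n m S T x' y' ->
      chain_value R N n m c d x' y' <= chain_value R N n m c d x y.
Proof.
move=> [x0 [y0 xy0]]; pose L := (n * m)%N.
(* A pair of chains with [L.+1] points each is one row vector of length [2 * L.+1], written as a
   successor for [inord]; the [x] coordinates come first, then the [y] coordinates. *)
pose X (v : 'rV[R]_(L + L.+1).+1) (k : nat) : R := v 0 (inord k).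
pose Y (v : 'rV[R]_(L + L.+1).+1) (k : nat) : R := v 0 (inord (L.+1 + k)).
pose A := [set v : 'rV[R]_(L + L.+1).+1 | forall i, `[0, 1]%classic (v ord0 i)] `&`
          [set v | cell_chain R n m S T (X v) (Y v)].
have cX k : continuous (X ^~ k) by exact: coord_continuous.
have cY k : continuous (Y ^~ k) by exact: coord_continuous.
have cA : compact A.
  apply: compact_closedI; last exact: cell_chain_closed.
  by apply: (@rV_compact R _ (fun=> `[0, 1]%classic)) => i; exact: segment_compact.
pose V (x y : nat -> R) : 'rV[R]_(L + L.+1).+1 :=
  \row_i (if (i <= L)%N then x i else y (i - L.+1)%N).
have XV x y k : (k <= L)%N -> x k = X (V x y) k.
  by move=> kL; rewrite /X mxE inordK ?kL//; lia.
have YV x y k : (k <= L)%N -> y k = Y (V x y) k.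
  move=> kL; rewrite /Y mxE inordK; last lia.
  by rewrite ifF ?addKn//; lia.
have AV x y : cell_chain R n m S T x y -> A (V x y).
  move=> xy; split => /=; last by apply: cell_chain_ext xy => k kL; [exact: XV|exact: YV].
  move=> i; rewrite mxE in_itv/=; have iL := ltn_ord i.
  case: ifPn => h; first by have [] := cell_chain_itv01 _ _ xy _ h.
  have iL' : (i - L.+1 <= n * m)%N by move: iL h; rewrite /L; lia.
  by have [] := cell_chain_itv01 _ _ xy _ iL'.
have [||v /set_mem Av vmax] := @compact_EVT_max _ R
    (fun v => chain_value R N n m c d (X v) (Y v)) A _ cA.
- by exists (V x0 y0); exact: AV.
- by apply: continuous_subspaceT; exact: chain_value_continuous.
exists (X v), (Y v); split; first by case: Av.
move=> x' y' xy'; have := vmax (V x' y') (mem_set (AV _ _ xy')).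
by rewrite (chain_value_ext x' y' (X (V x' y')) (Y (V x' y'))) => // k kL; [exact: XV|exact: YV].
Qed.

End chain_max.

(** * Piecewise linear interpolation *)

Lemma node_locate (R : realType) (u : nat -> R) (L : nat) (t : R) :
  u 0%N <= t <= u L ->
  (exists2 k, (k <= L)%N & t = u k) \/ (exists2 k, (k < L)%N & u k < t < u k.+1).
Proof.
elim: L => [|L IH].
  by move=> h; left; exists 0%N => //; apply/eqP; rewrite eq_le andbC.
move=> /andP[t0]; have [tL _|Lt] := leP t (u L).
  have [|[k kL tk]|[k kL tk]] := IH; first by rewrite t0.
    by left; exists k => //; exact: leqW.
  by right; exists k => //; exact: leqW.
rewrite le_eqVlt => /predU1P[->|tL]; first by left; exists L.+1.
by right; exists L => //; rewrite Lt.
Qed.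

Section grid.
Variable R : realType.
Local Notation mu := (@lebesgue_measure R).

Lemma countable_measurableR (E : set R) : countable E -> measurable E.
Proof. by apply: countable_measurable => t; exact: measurable_set1. Qed.

Definition grid (L k : nat) : R := k%:R / L%:R.

Lemma grid0 L : grid L 0 = 0. Proof. by rewrite /grid mul0r. Qed.

Lemma gridL L : (0 < L)%N -> grid L L = 1.
Proof. by move=> L0; rewrite /grid divff// pnatr_eq0; lia. Qed.

Lemma gridS L k : (0 < L)%N -> grid L k.+1 = grid L k + L%:R^-1.
Proof. by move=> L0; rewrite /grid -natr1 mulrDl mul1r. Qed.

Lemma grid_lt L k : (0 < L)%N -> grid L k < grid L k.+1.
Proof. by move=> L0; rewrite gridS// ltrDl invr_gt0 ltr0n. Qed.

Lemma grid_itv01 L k : (0 < L)%N -> (k <= L)%N -> 0 <= grid L k <= 1.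
Proof.
move=> L0 kL; rewrite /grid divr_ge0//= ler_pdivrMr ?ltr0n// mul1r ler_nat//.
Qed.

(* For [x 0 = 0], the interpolation on [[0, 1]] of the values [x k] at [k / L]. *)
Definition pl (L : nat) (x : nat -> R) (t : R) : R :=
  \sum_(k < L) (x k.+1 - x k) * clamp01 R (L%:R * t - k%:R).

Variable (L : nat) (x : nat -> R).
Hypotheses (L0 : (0 < L)%N) (x0 : x 0%N = 0) (xL : x L = 1)
  (xle : forall k, (k < L)%N -> x k <= x k.+1).

Let L0R : (0 : R) < L%:R. Proof. by rewrite ltr0n. Qed.

Lemma sum_increments (j : nat) : \sum_(k < j) (x k.+1 - x k) = x j.
Proof.
elim: j => [|j IH]; first by rewrite big_ord0 x0.
by rewrite big_ord_recr/= IH addrC subrK.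
Qed.

(** At such a [t] the ramps of index below [k] are saturated at 1 and their increments telescope to
    [x k], while those of index above [k] are still 0. *)
Lemma pl_affine k t : (k < L)%N -> grid L k <= t <= grid L k.+1 ->
  pl L x t = x k + (x k.+1 - x k) * (L%:R * t - k%:R).
Proof.
move=> kL; rewrite /grid ler_pdivrMr// ler_pdivlMr// mulrC => /andP[t1 t2].
have part j : \sum_(i < j) (x i.+1 - x i) * clamp01 R (L%:R * t - i%:R) =
    if (j <= k)%N then x j else x k + (x k.+1 - x k) * (L%:R * t - k%:R).
  elim: j => [|j IH]; first by rewrite big_ord0 x0.
  rewrite big_ord_recr/= IH; case: ltngtP => // jk.
  - have h : (j.+1%:R : R) <= k%:R by rewrite ler_nat.
    rewrite -natr1 in h.
    rewrite /clamp01 min_r ?max_r; [by rewrite mulr1 addrC subrK|lra|lra].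
  - have h : (k.+1%:R : R) <= j%:R by rewrite ler_nat.
    rewrite /clamp01 min_l; last by move: h t2; lra.
    by rewrite max_l ?mulr0 ?addr0//; lra.
  - rewrite jk clamp01_id//; apply/andP; split; first lra.
    by move: t2; rewrite -natr1; lra.
by rewrite /pl part leqNgt kL.
Qed.

(** Each ramp is [L]-Lipschitz, and the increments are nonnegative weights of sum 1. *)
Lemma pl_dist a b : `|pl L x b - pl L x a| <= L%:R * `|b - a|.
Proof.
rewrite /pl -sumrB; apply: (le_trans (ler_norm_sum _ _ _)).
have <- : \sum_(k < L) (x k.+1 - x k) * (L%:R * `|b - a|) = L%:R * `|b - a|.
  by rewrite -mulr_suml sum_increments xL mul1r.
apply: ler_sum => k _; rewrite -mulrBr normrM ger0_norm ?subr_ge0 ?xle//.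
apply: ler_wpM2l; first by rewrite subr_ge0 xle.
apply: (le_trans (clamp01_dist _ _ _)).
rewrite (_ : _ - _ = L%:R * (b - a)); last by ring.
by rewrite normrM gtr0_norm.
Qed.

Lemma pl0 : pl L x 0 = 0.
Proof.
rewrite (@pl_affine 0)// ?grid0 ?lexx/= ?x0; first by rewrite mulr0 subrr mulr0 addr0.
by rewrite -(grid0 L); exact/ltW/grid_lt.
Qed.

Lemma pl1 : pl L x 1 = 1.
Proof.
have [k kE] : exists k, L = k.+1 by exists L.-1; rewrite prednK.
have gk : grid L k.+1 = 1 by rewrite -kE gridL.
have xk : x k.+1 = 1 by rewrite -kE.
have LR : L%:R = k%:R + 1 :> R by rewrite kE natr1.
have kL : (k < L)%N by rewrite kE.
have g1 : grid L k <= 1 <= grid L k.+1.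
  by rewrite gk lexx andbT -gk; exact/ltW/grid_lt.
by rewrite (pl_affine _ _ kL g1) xk LR; ring.
Qed.

Lemma pl_itv01 t : 0 <= pl L x t <= 1.
Proof.
apply/andP; split.
  apply: sumr_ge0 => k _; rewrite mulr_ge0 ?subr_ge0 ?xle//.
  by have /andP[] := clamp01_itv R (L%:R * t - k%:R).
rewrite -xL -sum_increments; apply: ler_sum => k _.
rewrite ler_piMr ?subr_ge0 ?xle//.
by have /andP[] := clamp01_itv R (L%:R * t - k%:R).
Qed.

Lemma pl_continuous : continuous (pl L x).
Proof.
move=> t; apply/cvgrPdist_lt => e e0; near=> s.
apply: (le_lt_trans (pl_dist _ _)); rewrite mulrC -ltr_pdivlMr//.
near: s; apply: (@cvgr_dist_lt _ _ _ _ _ id t); first exact: cvg_id.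
by rewrite divr_gt0.
Unshelve. all: by end_near. Qed.

Lemma pl_abs_continuous : abs_continuous (pl L x).
Proof.
move=> e e0; exists (e / L%:R); first by rewrite divr_gt0.
move=> n a b ab _; rewrite ltr_pdivlMr// mulrC mulr_sumr; apply: le_lt_trans.
apply: ler_sum => i _; apply: (le_trans (pl_dist _ _)).
by rewrite ger0_norm// subr_ge0; have [_ []] := ab i.
Qed.

Lemma pl_is_derive k t : (k < L)%N -> grid L k < t < grid L k.+1 ->
  is_derive t 1 (pl L x) (L%:R * (x k.+1 - x k)).
Proof.
move=> kL tk.
apply: (@near_eq_is_derive _ _ _ (fun t => (L%:R * (x k.+1 - x k)) * t +
   (x k - (x k.+1 - x k) * k%:R))).
- have : t \in `]grid L k, grid L k.+1[ by rewrite in_itv.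
  move=> /near_in_itvoo; apply: filterS => s; rewrite in_itv/= => /andP[s1 s2].
  by rewrite (@pl_affine k)// ?(ltW s1) ?(ltW s2)//; ring.
- apply: is_derive_eq.
  by rewrite addr0 scaler1.
Qed.

Lemma countable_grid : countable (range (grid L)).
Proof. by apply: card_le_trans (card_image_le _ _) _; exact: countableP. Qed.

Lemma off_grid t : I01 R t -> ~ range (grid L) t ->
  exists2 k, (k < L)%N & grid L k < t < grid L k.+1.
Proof.
rewrite /I01/= in_itv/= => t01 ng.
have [||//] := @node_locate _ (grid L) L t; first by rewrite grid0 gridL.
by move=> [k _ tk]; exfalso; apply: ng; exists k.
Qed.

Lemma off_grid_ae (P : R -> Prop) :
  (forall k t, (k < L)%N -> grid L k < t < grid L k.+1 -> P t) ->
  {ae mu, forall t, I01 R t -> P t}.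
Proof.
move=> HP; exists (range (grid L)); split.
- exact: (countable_measurableR _ countable_grid).
- exact: (countable_lebesgue_measure0 countable_grid).
- move=> t /= h; apply: contrapT => ng; apply: h => It.
  by have [k kL tk] := off_grid _ It ng; exact: (HP _ _ kL tk).
Qed.

Lemma pl_Gamma_tilde : Gamma_tilde (pl L x).
Proof.
split.
- by move=> t _; rewrite /I01/= in_itv/=; exact: pl_itv01.
- exact: pl_abs_continuous.
- exact: pl0.
- exact: pl1.
- apply: off_grid_ae => k t kL tk; have dt := pl_is_derive _ _ kL tk; split.
    exact: (@ex_derive _ _ _ _ _ _ _ dt).
  by rewrite derive1E (@derive_val _ _ _ _ _ _ _ dt) mulr_ge0// subr_ge0 xle.
Qed.

Lemma pl_Gamma : (forall k, (k < L)%N -> x k < x k.+1) -> Gamma (pl L x).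
Proof.
move=> xlt; split; first exact: pl_Gamma_tilde.
apply: off_grid_ae => k t kL tk; have dt := pl_is_derive _ _ kL tk; split.
  exact: (@ex_derive _ _ _ _ _ _ _ dt).
by rewrite derive1E (@derive_val _ _ _ _ _ _ _ dt) mulr_gt0// subr_gt0 xlt.
Qed.

Lemma pl_piecewise_linear : piecewise_linear (pl L x).
Proof.
split; first by apply: continuous_subspaceT; exact: pl_continuous.
have nthE i : (i <= L)%N -> nth 0 (0 :: mkseq (fun k => grid L k.+1) L) i = grid L i.
  by case: i => [|i] iL; [rewrite grid0|rewrite /= nth_mkseq].
exists (mkseq (fun k => grid L k.+1) L); first split.
- apply/(pathP 0) => i; rewrite size_mkseq => iL.
  by rewrite nthE ?(ltnW iL)// nth_mkseq// grid_lt.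
- have sL : size (mkseq (fun k => grid L k.+1) L) = L by rewrite size_mkseq.
  by rewrite (last_nth 0) sL nthE// gridL.
- move=> i; rewrite size_mkseq => iL; rewrite !nthE ?(ltnW iL)//.
  exists (L%:R * (x i.+1 - x i)), (x i - (x i.+1 - x i) * i%:R) => t.
  rewrite /= in_itv/= => /andP[t1 t2]; rewrite (@pl_affine i) ?(ltW t1) ?(ltW t2)//.
  by ring.
Qed.

(** Every subset of a countable set is Borel, so arbitrary values on [E], such as those of [derive1]
    at grid points, do no harm. *)
Lemma measurable_fun_off_countable (D E : set R) (f h : R -> R) : countable E ->
  (forall t, D t -> ~ E t -> f t = h t) -> measurable_fun D h -> measurable_fun D f.
Proof.
move=> cE fh mh mD Y mY.
rewrite (_ : D `&` f @^-1` Y = ((D `&` h @^-1` Y) `\` E) `|` (D `&` f @^-1` Y `&` E)).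
  apply: measurableU; first by apply: measurableD; [exact: mh|exact: countable_measurableR].
  by apply: countable_measurableR; apply: sub_countable cE; apply: subset_card_le => t [].
apply/seteqP; split => t /=.
  move=> [Dt Yt]; have [Et|nEt] := pselect (E t); first by right.
  by left; rewrite -fh.
by move=> [[[Dt Yt] nEt]|[[]]//]; rewrite -fh in Yt.
Qed.

Lemma measurable_derive1_pl : measurable_fun (I01 R) (derive1 (pl L x)).
Proof.
pose G := `]0, 1[%classic `\` range (grid L).
have mG : measurable G.
  by apply: measurableD => //; exact: (countable_measurableR _ countable_grid).
have It t : G t -> I01 R t by move=> [/= h _]; exact: subset_itv_oo_cc.
apply: (@measurable_fun_off_countable _ _ _ (derive1 (pl L x) \_ G) countable_grid).
  move=> t t01 ng; rewrite patchE mem_set//; split => //.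
  have [k kL /andP[t1 t2]] := off_grid _ t01 ng.
  have /andP[g0 _] := grid_itv01 L k L0 (ltnW kL).
  have /andP[_ g1] := grid_itv01 L k.+1 L0 kL.
  by rewrite /= in_itv/= (le_lt_trans g0 t1) (lt_le_trans t2 g1).
apply: measurable_funTS; apply: density_measurable => //.
- exact: pl_Gamma_tilde.
- by move=> t [].
- move=> t Gt; have [k kL tk] := off_grid _ (It _ Gt) Gt.2.
  have dt := pl_is_derive _ _ kL tk; split.
    exact: (@ex_derive _ _ _ _ _ _ _ dt).
  by rewrite derive1E (@derive_val _ _ _ _ _ _ _ dt) mulr_ge0// subr_ge0 xle.
Qed.

End grid.

(** * The action of piecewise linear interpolations on a step function *)

Section act_pl.
Variables (R : realType) (N : nat).
Local Notation mu := (@lebesgue_measure R).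

Lemma lebesgue_I01 : mu (I01 R) = 1%E.
Proof. by rewrite /I01 lebesgue_measure_itv/= lte_fin ltr01 -EFinD subr0. Qed.

Variables (q : R -> 'rV[R]_N) (n : nat) (S : nat -> R) (c : nat -> 'rV[R]_N).
Hypotheses (mq : forall i, measurable_fun (I01 R) (fun t => q t 0 i))
  (S0 : S 0%N = 0) (Sn : S n = 1)
  (Sq : forall i, (i < n)%N -> forall t, S i < t < S i.+1 -> q t = c i).

(** There are finitely many values: the [c k], and the unconstrained ones at the nodes [S k]. The
    sum of their squared norms bounds each of them. *)
Lemma step_function_bounded : exists2 B, 0 <= B & forall t, I01 R t -> dot (q t) (q t) <= B.
Proof.
exists (\sum_(k < n.+1) dot (q (S k)) (q (S k)) + \sum_(k < n) dot (c k) (c k)).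
  by rewrite addr_ge0// sumr_ge0// => k _; exact: dot_ge0.
move=> t; rewrite /I01/= in_itv/= => t01.
have [||] := @node_locate _ S n t; first by rewrite S0 Sn.
- move=> [k kn ->]; apply: ler_wpDr; first by rewrite sumr_ge0// => i _; exact: dot_ge0.
  rewrite (bigD1 (Ordinal (kn : (k < n.+1)%N)))//= lerDl sumr_ge0// => i _.
  exact: dot_ge0.
- move=> [k kn tk]; apply: ler_wpDl; first by rewrite sumr_ge0// => i _; exact: dot_ge0.
  rewrite (Sq k kn)// (bigD1 (Ordinal kn))//= lerDl sumr_ge0// => i _.
  exact: dot_ge0.
Qed.

Variable (L : nat).
Hypothesis (L0 : (0 < L)%N).

Let L0R : (0 : R) < L%:R. Proof. by rewrite ltr0n. Qed.

Lemma act_pl_measurable (x : nat -> R) : x 0%N = 0 -> x L = 1 ->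
  (forall k, (k < L)%N -> x k <= x k.+1) ->
  forall i, measurable_fun (I01 R) (fun t => act q (pl R L x) t 0 i).
Proof.
move=> x0 xL xle i.
rewrite (_ : (fun _ => _) =
  (fun t => Num.sqrt (derive1 (pl R L x) t) * q (pl R L x t) 0 i)).
  apply: measurable_funM.
    by apply: measurable_sqrt_comp; exact: measurable_derive1_pl.
  apply: (@measurable_comp_I01 _ (fun s => q s 0 i)) => //.
  exact: pl_Gamma_tilde.
by apply/funext => t; rewrite mxE.
Qed.

Lemma increment_le1 (x : nat -> R) k : x 0%N = 0 -> x L = 1 ->
  (forall k, (k < L)%N -> x k <= x k.+1) -> (k < L)%N -> 0 <= x k.+1 - x k <= 1.
Proof.
move=> x0 xL xle kL; rewrite subr_ge0 xle//=.
have /(_ 0%N k isT (ltnW kL)) := nondecreasing_upto _ _ _ xle.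
have /(_ k.+1 L kL (leqnn L)) := nondecreasing_upto _ _ _ xle.
by rewrite x0 xL; lra.
Qed.

Lemma derive1_pl (x : nat -> R) k t : x 0%N = 0 -> (k < L)%N ->
  grid R L k < t < grid R L k.+1 ->
  derive1 (pl R L x) t = L%:R * (x k.+1 - x k).
Proof.
move=> x0 kL tk; have dt := pl_is_derive R L x L0 x0 k t kL tk.
by rewrite derive1E (@derive_val _ _ _ _ _ _ _ dt).
Qed.

(** The slope of [pl L x] off the grid is [L] times an increment, hence at most [L]. *)
Lemma act_pl_bound (x : nat -> R) B t : x 0%N = 0 -> x L = 1 ->
  (forall k, (k < L)%N -> x k <= x k.+1) ->
  (forall t, I01 R t -> dot (q t) (q t) <= B) ->
  I01 R t -> ~ range (grid R L) t ->
  dot (act q (pl R L x) t) (act q (pl R L x) t) <= L%:R * B.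
Proof.
move=> x0 xL xle qB It ng; have [k kL tk] := off_grid R L L0 t It ng.
have /andP[i0 i1] := increment_le1 _ _ x0 xL xle kL.
rewrite /act dotZ (derive1_pl _ k)// -expr2 sqr_sqrtr ?mulr_ge0// -mulrA.
apply: ler_wpM2l => //.
have It' : I01 R (pl R L x t) by rewrite /I01/= in_itv/=; exact: pl_itv01.
have := qB _ It'; have := dot_ge0 _ _ (q (pl R L x t)).
by move=> h1 h2; apply: le_trans h2; rewrite ler_piMl.
Qed.

Lemma I01_off_grid_integral (f : R -> \bar R) : measurable_fun (I01 R) f ->
  (forall t, I01 R t -> 0 <= f t)%E ->
  (\int[mu]_(t in I01 R) f t = \int[mu]_(t in I01 R `\` range (grid R L)) f t)%E.
Proof.
move=> mf f0; apply: ge0_negligible_integral => //.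
- exact: (countable_measurableR _ _ (countable_grid R L)).
- exact: measurable_itv.
- exact: (countable_lebesgue_measure0 (countable_grid R L)).
Qed.

Lemma L2_act_pl (x : nat -> R) : x 0%N = 0 -> x L = 1 ->
  (forall k, (k < L)%N -> x k <= x k.+1) -> L2 (act q (pl R L x)).
Proof.
move=> x0 xL xle; have ma := act_pl_measurable _ x0 xL xle.
split => //.
have [B B0 qB] := step_function_bounded.
have mI : measurable (I01 R) by exact: measurable_itv.
have fin : (\int[mu]_(t in I01 R)
    (dot (act q (pl R L x) t) (act q (pl R L x) t))%:E < +oo)%E.
  rewrite I01_off_grid_integral; first last.
  - by move=> t _; rewrite lee_fin dot_ge0.
  - by apply/measurable_EFinP; exact: measurable_dot.
  apply: (@le_lt_trans _ _ (\int[mu]_(t in I01 R) (cst (L%:R * B)%:E t))%E).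
    apply: ge0_integral_le.
    - exact: subDsetl.
    - by move=> t _; rewrite lee_fin dot_ge0.
    - by move=> t _; rewrite lee_fin mulr_ge0.
    - by move=> t [It ng]; rewrite lee_fin; exact: act_pl_bound.
  by rewrite integral_cst// [X in (_ * X)%E](_ : _ = 1%E) ?mule1 ?ltry//; exact: lebesgue_I01.
by move: fin; rewrite /L2norm; case: (integral _ _ _) => [r||]//= _; exact: ltry.
Qed.

End act_pl.

(** * The inner product along two piecewise linear paths *)

Section inner_value.
Variables (R : realType) (N : nat).
Local Notation mu := (@lebesgue_measure R).

(** On a grid interval, of length [1 / L], the slopes are [L dx] and [L dy], so the integrand is the
    constant [L * V k * sqrt (dx dy)]. Where one path is at rest it vanishes, whatever values [q]
    and [w] take there. *)
Lemma act_pl_inner (q w : R -> 'rV[R]_N) (L : nat) (x y V : nat -> R) : (0 < L)%N ->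
  x 0%N = 0 -> x L = 1 -> (forall k, (k < L)%N -> x k <= x k.+1) ->
  y 0%N = 0 -> y L = 1 -> (forall k, (k < L)%N -> y k <= y k.+1) ->
  L2 (act q (pl R L x)) -> L2 (act w (pl R L y)) ->
  (forall k, (k < L)%N -> [\/ x k = x k.+1, y k = y k.+1 |
     forall s r, x k < s < x k.+1 -> y k < r < y k.+1 -> dot (q s) (w r) = V k]) ->
  L2inner (act q (pl R L x)) (act w (pl R L y)) =
  \sum_(k < L) V k * Num.sqrt ((x k.+1 - x k) * (y k.+1 - y k)).
Proof.
move=> L0 x0 xL xle y0 yL yle q2 w2 HV.
have fi := L2_dot_integrable _ _ _ _ q2 w2.
have IE : I01 R = `[grid R L 0%N, grid R L L]%classic by rewrite grid0 gridL.
have L0R : (0 : R) < L%:R by rewrite ltr0n.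
rewrite /L2inner IE Rintegral_nodes; last 2 first.
- by move=> k kL; exact/ltW/grid_lt.
- by rewrite -IE.
apply: eq_bigr => k _; have kL := ltn_ord k.
pose r := L%:R * (V k * Num.sqrt ((x k.+1 - x k) * (y k.+1 - y k))).
rewrite (@eq_Rintegral _ _ _ _ _ (cst r)); last first.
  move=> t /set_mem; rewrite /= in_itv/= => tk.
  have dx := derive1_pl R L L0 _ _ _ x0 kL tk.
  have dy := derive1_pl R L L0 _ _ _ y0 kL tk.
  rewrite /act dotZ dx dy /r.
  have [e|e|e] := HV k kL.
  - by rewrite e subrr mulr0 !mul0r sqrtr0 !(mul0r, mulr0).
  - by rewrite e subrr !mulr0 sqrtr0 !(mul0r, mulr0).
  have [xx|xx] := eqVneq (x k) (x k.+1).
    by rewrite xx subrr mulr0 !mul0r sqrtr0 !(mul0r, mulr0).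
  have [yy|yy] := eqVneq (y k) (y k.+1).
    by rewrite yy subrr !mulr0 sqrtr0 !(mul0r, mulr0).
  have {}xx : 0 < x k.+1 - x k by rewrite subr_gt0 lt_neqAle xx xle.
  have {}yy : 0 < y k.+1 - y k by rewrite subr_gt0 lt_neqAle yy yle.
  have /andP[t1 t2] := tk.
  have tc : grid R L k <= t <= grid R L k.+1 by rewrite !ltW.
  have u01 : 0 < L%:R * t - k%:R < 1.
    move: t1 t2; rewrite /grid ltr_pdivrMr// ltr_pdivlMr// -natr1 mulrC; lra.
  rewrite (pl_affine R L x L0 x0 k t kL tc) (pl_affine R L y L0 y0 k t kL tc) e.
  - rewrite !sqrtrM ?(ltW L0R) ?(ltW xx)//.
    rewrite -[L%:R in RHS](sqr_sqrtr (ltW L0R)); ring.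
  - move: u01 xx; move: (L%:R * t - k%:R) => u /andP[u0 u1] xx.
    have := mulr_gt0 xx u0; have : (x k.+1 - x k) * u < x k.+1 - x k by rewrite gtr_pMr.
    by lra.
  - move: u01 yy; move: (L%:R * t - k%:R) => u /andP[u0 u1] yy.
    have := mulr_gt0 yy u0; have : (y k.+1 - y k) * u < y k.+1 - y k by rewrite gtr_pMr.
    by lra.
have gE : mu `]grid R L k, grid R L k.+1[ = (L%:R^-1)%:E.
  rewrite lebesgue_measure_itv/= lte_fin grid_lt// -EFinD gridS//.
  by rewrite (addrC (grid R L k)) addrK.
rewrite Rintegral_cst// [X in _ * fine X](_ : _ = (L%:R^-1)%:E)//.
by rewrite /= /r mulrAC mulfV ?mul1r// gt_eqF.
Qed.

End inner_value.

(** * Piecewise linear actions as limits of orbit elements *)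

Section closure.
Variables (R : realType) (N : nat).
Local Notation mu := (@lebesgue_measure R).

Lemma dot_sub_le (u v : 'rV[R]_N) : dot (u - v) (u - v) <= 2 * dot u u + 2 * dot v v.
Proof.
rewrite /dot !mulr_sumr -big_split/=; apply: ler_sum => i _; rewrite !mxE.
by have := sqr_ge0 (u 0 i + v 0 i); nra.
Qed.

Variables (q : R -> 'rV[R]_N) (n : nat) (S : nat -> R) (c : nat -> 'rV[R]_N).
Hypotheses (mq : forall i, measurable_fun (I01 R) (fun t => q t 0 i))
  (S0 : S 0%N = 0) (Sn : S n = 1)
  (Sq : forall i, (i < n)%N -> forall t, S i < t < S i.+1 -> q t = c i).
Variables (L : nat) (x : nat -> R).
Hypotheses (L0 : (0 < L)%N) (x0 : x 0%N = 0) (xL : x L = 1)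
  (xle : forall k, (k < L)%N -> x k <= x k.+1).

Let L0R : (0 : R) < L%:R. Proof. by rewrite ltr0n. Qed.

(** The grid values of [(1 - e) * pl L x + e * id]; for [0 < e <= 1] they increase strictly, which
    puts the interpolation in [Gamma]. *)
Definition perturb (e : R) (k : nat) : R := (1 - e) * x k + e * grid R L k.

Lemma perturb0 e : perturb e 0 = 0.
Proof. by rewrite /perturb x0 grid0 !mulr0 addr0. Qed.

Lemma perturbL e : perturb e L = 1.
Proof. by rewrite /perturb xL gridL// !mulr1 subrK. Qed.

Lemma perturb_increment e k : perturb e k.+1 - perturb e k =
  (1 - e) * (x k.+1 - x k) + e / L%:R.
Proof. by rewrite /perturb gridS//; ring. Qed.

Lemma perturb_lt e k : 0 < e -> e <= 1 -> (k < L)%N -> perturb e k < perturb e k.+1.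
Proof.
move=> e0 e1 kL; rewrite -subr_gt0 perturb_increment ltr_wpDl ?divr_gt0//.
by rewrite mulr_ge0 ?subr_ge0// xle.
Qed.

Lemma pl_perturb e k t : (k < L)%N -> grid R L k < t < grid R L k.+1 ->
  pl R L (perturb e) t = (1 - e) * pl R L x t + e * t.
Proof.
move=> kL /andP[t1 t2].
have tc : grid R L k <= t <= grid R L k.+1 by rewrite !ltW.
rewrite (pl_affine R L _ L0 (perturb0 e) k t kL tc) (pl_affine R L x L0 x0 k t kL tc).
rewrite perturb_increment /perturb /grid; field.
by rewrite gt_eqF.
Qed.

(* Grid points, and times at which [pl L x] crosses some [S i] with nonzero speed. *)
Let bad : set R := range (grid R L) `|`
  range (fun p : nat * nat => ((S p.2 - x p.1) / (x p.1.+1 - x p.1) + p.1%:R) / L%:R).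

Let countable_bad : countable bad.
Proof.
rewrite /bad -bigcup2E; apply: bigcup_countable => // i _.
case: i => [|[|i]] /=; [exact: countable_grid| |exact: countable0].
by apply: card_le_trans (card_image_le _ _) _; exact: countableP.
Qed.

Let err (e : R) (t : R) : R :=
  dot (act q (pl R L x) t - act q (pl R L (perturb e)) t)
      (act q (pl R L x) t - act q (pl R L (perturb e)) t).

Let eps (j : nat) : R := j.+1%:R^-1.

Let eps_gt0 j : 0 < eps j. Proof. by rewrite invr_gt0. Qed.
Let eps_le1 j : eps j <= 1. Proof. by rewrite invf_le1// ler1n. Qed.
Let eps_cvg : eps @ \oo --> 0. Proof. exact: cvg_harmonic. Qed.

(** Where [pl L x] is at rest, its action vanishes and the perturbed slope is [eps j], so the
    squared error is at most [eps j * B], even if the path rests on a node of [S]. Elsewhere, as [t]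
    is not bad, [pl L x t] is interior to a piece of constancy [c i]; the perturbed path eventually
    lies in the same piece, and only the square roots of the slopes differ. *)
Let err_cvg t : I01 R t -> ~ bad t -> err (eps j) t @[j --> \oo] --> 0.
Proof.
move=> It nb.
have ng : ~ range (grid R L) t by move=> h; apply: nb; left.
have [k kL tk] := off_grid R L L0 t It ng.
have dE y : y 0%N = 0 -> derive1 (pl R L y) t = L%:R * (y k.+1 - y k).
  by move=> y0; exact: derive1_pl.
have [B B0 qB] := step_function_bounded R N q n S c S0 Sn Sq.
have [xx|xx] := eqVneq (x k) (x k.+1).
  have errE j : 0 <= err (eps j) t <= eps j * B.
    rewrite dot_ge0/= /err /act (dE x)// (dE _ (perturb0 _)) perturb_increment.
    rewrite xx subrr !mulr0 sqrtr0 scale0r sub0r add0r -scaleNr dotZ mulrNN.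
    rewrite -expr2 sqr_sqrtr; last first.
      by rewrite mulr_ge0// divr_ge0// ltW.
    rewrite mulrCA mulfV ?gt_eqF// mulr1; apply: ler_wpM2l; first exact: ltW.
    apply: qB; rewrite /I01/= in_itv/=; apply: pl_itv01 => //.
    - exact: perturb0.
    - exact: perturbL.
    - by move=> i iL; apply/ltW/perturb_lt.
  apply: (@squeeze_cvgr _ _ _ _ (fun=> 0) (fun j => eps j * B)).
  - by apply: nearW => j.
  - exact: cvg_cst.
  - by rewrite -(mul0r B); apply: cvgM; [exact: eps_cvg|exact: cvg_cst].
have {}xx : 0 < x k.+1 - x k by rewrite subr_gt0 lt_neqAle xx xle.
have /andP[t1 t2] := tk.
have tc : grid R L k <= t <= grid R L k.+1 by rewrite !ltW.
have [i iN Si] : exists2 i, (i < n)%N & S i < pl R L x t < S i.+1.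
  have [||//] := @node_locate _ S n (pl R L x t); first by rewrite S0 Sn pl_itv01.
  move=> [i iN E]; exfalso; apply: nb; right; exists (k, i) => //=.
  rewrite -E (pl_affine R L x L0 x0 k t kL tc); field.
  by rewrite !gt_eqF.
have plcvg : pl R L (perturb (eps j)) t @[j --> \oo] --> pl R L x t.
  rewrite (_ : (fun j => _) = (fun j => (1 - eps j) * pl R L x t + eps j * t)); last first.
    by apply/funext => j; rewrite (pl_perturb _ k).
  rewrite -[X in _ --> X]addr0 -(mul0r t) -[X in _ --> X + _]mul1r.
  apply: cvgD; last by apply: cvgM; [exact: eps_cvg|exact: cvg_cst].
  apply: cvgM; last exact: cvg_cst.
  by rewrite -[X in _ --> X]subr0; apply: cvgB; [exact: cvg_cst|exact: eps_cvg].
pose rt e := Num.sqrt (L%:R * (x k.+1 - x k)) -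
  Num.sqrt (L%:R * ((1 - e) * (x k.+1 - x k) + e / L%:R)).
have errE : \forall j \near \oo, rt (eps j) ^+ 2 * dot (c i) (c i) = err (eps j) t.
  have /andP[Si1 Si2] := Si.
  near=> j.
  have Sj : S i < pl R L (perturb (eps j)) t < S i.+1.
    by apply/andP; split; near: j; [exact: (cvgr_gt _ plcvg)|exact: (cvgr_lt _ plcvg)].
  rewrite /err /act (dE x)// (dE _ (perturb0 _)) perturb_increment (Sq i iN _ Si).
  by rewrite (Sq i iN _ Sj) -scalerBl dotZ -expr2.
have rcvg : rt (eps j) @[j --> \oo] --> 0.
  rewrite -(subrr (Num.sqrt (L%:R * (x k.+1 - x k)))).
  apply: cvgB; first exact: cvg_cst.
  apply: (@cvg_comp _ _ _ (fun j => L%:R * ((1 - eps j) * (x k.+1 - x k) + eps j / L%:R))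
    Num.sqrt _ (nbhs (L%:R * (x k.+1 - x k)))); last exact: sqrt_continuous.
  apply: cvgM; first exact: cvg_cst.
  rewrite -[X in _ --> X]addr0 -(mul0r L%:R^-1) -[X in _ --> X + _]mul1r.
  apply: cvgD; last by apply: cvgM; [exact: eps_cvg|exact: cvg_cst].
  apply: cvgM; last exact: cvg_cst.
  by rewrite -[X in _ --> X]subr0; apply: cvgB; [exact: cvg_cst|exact: eps_cvg].
apply: cvg_trans; first by apply: near_eq_cvg; exact: errE.
rewrite -(mul0r (dot (c i) (c i))); apply: cvgM; last exact: cvg_cst.
by have h := cvgM rcvg rcvg; rewrite mulr0 in h; exact: h.
Unshelve. all: by end_near. Qed.

Lemma act_pl_in_orbit_closure : orbit_closure q (act q (pl R L x)).
Proof.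
split; first exact: (L2_act_pl R N q n S c mq S0 Sn Sq L L0 x x0 xL xle).
move=> e e0.
have [B B0 qB] := step_function_bounded R N q n S c S0 Sn Sq.
have ple j k : (k < L)%N -> perturb (eps j) k <= perturb (eps j) k.+1.
  by move=> kL; apply/ltW/perturb_lt.
have mI : measurable (I01 R) by exact: measurable_itv.
have mB (f g : R -> 'rV[R]_N) :
    (forall i, measurable_fun (I01 R) (fun t => f t 0 i)) ->
    (forall i, measurable_fun (I01 R) (fun t => g t 0 i)) ->
    forall i, measurable_fun (I01 R) (fun t => (f t - g t) 0 i).
  move=> mf mg i; rewrite (_ : (fun _ => _) = (fun t => f t 0 i - g t 0 i)).
    exact: measurable_funB.
  by apply/funext => t; rewrite !mxE.
have merr j : measurable_fun (I01 R) (fun t => (err (eps j) t)%:E).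
  apply/measurable_EFinP; apply: measurable_dot; apply: mB;
    apply: act_pl_measurable => //; try exact: perturb0; try exact: perturbL;
    exact: ple.
have ae_good (P : R -> Prop) : (forall t, I01 R t -> ~ bad t -> P t) ->
    {ae mu, forall t, I01 R t -> P t}.
  move=> HP; exists bad; split.
  - exact: (countable_measurableR _ _ countable_bad).
  - exact: (countable_lebesgue_measure0 countable_bad).
  - by move=> t /= h; apply: contrapT => nb; apply: h => It; exact: HP.
have [_ _ cvgI] : [/\ mu.-integrable (I01 R) (cst 0%E : R -> \bar R),
    [sequence (\int[mu]_(t in I01 R) `|(err (eps j) t)%:E - cst 0 t|)%E]_j @ \oo --> 0%E &
    [sequence (\int[mu]_(t in I01 R) (err (eps j) t)%:E)%E]_j @ \oo -->
      (\int[mu]_(t in I01 R) (cst 0%E t))%E].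
  (* The dominating constant comes from [|u - v|^2 <= 2 |u|^2 + 2 |v|^2], with both squared norms at
     most [L * B] off the grid, uniformly in [j]. *)
  apply: (@dominated_convergence _ _ _ mu (I01 R) mI
    (fun j t => (err (eps j) t)%:E) (cst 0%E) (cst (4 * (L%:R * B))%:E)) => //.
  - apply: ae_good => t It nb; apply: cvg_EFin; first exact: nearW.
    exact: err_cvg.
  - apply: (@continuous_compact_integrable R (fun=> 4 * (L%:R * B)) (I01 R)).
      exact: segment_compact.
    by apply: continuous_subspaceT => t; exact: cvg_cst.
  - have : {ae mu, forall t, I01 R t -> forall j,
        (`|(err (eps j) t)%:E| <= (4 * (L%:R * B))%:E)%E}.
      apply: ae_good => t It nb j.
      have ng : ~ range (grid R L) t by move=> h; apply: nb; left.
      rewrite /= lee_fin ger0_norm ?dot_ge0//; apply: (le_trans (dot_sub_le _ _)).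
      have h1 := act_pl_bound R N q L L0 x B t x0 xL xle qB It ng.
      have h2 := act_pl_bound R N q L L0 _ B t (perturb0 (eps j)) (perturbL (eps j))
        (ple j) qB It ng.
      by lra.
    move=> [A [mA A0 sA]]; exists A; split => //; apply: subset_trans sA => t /= h h'.
    by apply: h => j It; exact: h'.
move: cvgI; rewrite integral0 => /fine_cvgP[fin cvgf].
have [j [finj ltj]] : exists j,
    (\int[mu]_(t in I01 R) (err (eps j) t)%:E)%E \is a fin_num /\
    fine (\int[mu]_(t in I01 R) (err (eps j) t)%:E)%E < e ^+ 2.
  have e2 : 0 < e ^+ 2 by rewrite exprn_gt0.
  move/cvgrPdist_lt : cvgf => /(_ _ e2)/(filterI fin)/filter_ex[j /= [h1 h2]].
  by exists j; split => //; apply: le_lt_trans h2; rewrite sub0r normrN ler_norm.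
exists (pl R L (perturb (eps j))).
  apply: pl_Gamma => //; first exact: perturb0.
  - exact: perturbL.
  - exact: ple.
  - by move=> k kL; exact: perturb_lt.
rewrite /L2norm -[X in sqrte X]/(\int[mu]_(t in I01 R) (err (eps j) t)%:E)%E.
rewrite -(fineK finj) /= lte_fin -(ger0_norm (ltW e0)) -sqrtr_sqr ltr_sqrt//.
by rewrite exprn_gt0.
Qed.

End closure.

(* Each step of a chain is split into two; over the first half of a step of
   nonpositive weight only [x] moves, over the second half only [y]. *)
Section staircase.
Variables (R : realType) (W : nat -> R).

Definition stair_x (x : nat -> R) (k : nat) : R := x (uphalf k).

Definition stair_y (y : nat -> R) (k : nat) : R :=
  if odd k && (W k./2 <= 0) then y k./2 else y (uphalf k).

Lemma stair_x_double x l : stair_x x l.*2 = x l.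
Proof. by rewrite /stair_x uphalf_double. Qed.

Lemma stair_x_doubleS x l : stair_x x l.*2.+1 = x l.+1.
Proof. by rewrite /stair_x /= doubleK. Qed.

Lemma stair_y_double y l : stair_y y l.*2 = y l.
Proof. by rewrite /stair_y odd_double uphalf_double. Qed.

Lemma stair_y_doubleS y l : stair_y y l.*2.+1 = if W l <= 0 then y l else y l.+1.
Proof. by rewrite /stair_y /= odd_double uphalf_double doubleK. Qed.

(** The odd terms vanish because [x] is at rest; an even term vanishes if [W k <= 0], because [y] is
    then at rest, and is the full term otherwise. Thus the signed weights yield their positive
    parts. *)
Lemma stair_sum (L : nat) (x y : nat -> R) :
  \sum_(k < L.*2) W k./2 * Num.sqrt ((stair_x x k.+1 - stair_x x k) *
    (stair_y y k.+1 - stair_y y k)) =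
  \sum_(k < L) Num.max 0 (W k) * Num.sqrt ((x k.+1 - x k) * (y k.+1 - y k)).
Proof.
elim: L => [|L IH]; first by rewrite !big_ord0.
rewrite doubleS !big_ord_recr/= IH -doubleS stair_x_double stair_x_doubleS.
rewrite stair_x_double stair_y_double stair_y_doubleS stair_y_double.
rewrite doubleK uphalf_double subrr mul0r sqrtr0 mulr0 addr0.
by case: leP => W0; rewrite ?subrr ?mulr0 ?sqrtr0 ?mulr0 ?mul0r.
Qed.

End staircase.

(** * Attainment of the supremum *)

Theorem theorem5 (R : realType) (N : nat) (q w : R -> 'rV[R]_N)
    (q_L2 : L2 q) (w_L2 : L2 w)
    (q_step : step_function q) (w_step : step_function w) :
  exists lambda gamma : R -> R,
    [/\ piecewise_linear lambda, piecewise_linear gamma,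
        Gamma_tilde lambda, Gamma_tilde gamma &
        (L2inner (act q lambda) (act w gamma))%:E =
        ereal_sup [set x : \bar R | exists qt wt : R -> 'rV[R]_N,
          [/\ orbit_closure q qt, orbit_closure w wt &
              x = (L2inner qt wt)%:E]]].
Proof.
have [n [S [c [S0 Sn SS Sq]]]] := step_function_data _ _ _ q_step.
have [m [T [d [T0 Tm TT Tw]]]] := step_function_data _ _ _ w_step.
have L0 : (0 < n * m)%N.
  rewrite muln_gt0 !lt0n; apply/andP; split; apply/eqP => E.
    by move: Sn; rewrite E S0; lra.
  by move: Tm; rewrite E T0; lra.
have ex_chain : exists x y, cell_chain R n m S T x y.
  (* This interpolation is the identity on I; the chain of the diagonal path shows that the set to
     be maximized over is nonempty. *)
  have Gid : Gamma (pl R 1 (fun k => k%:R)).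
    by apply: pl_Gamma => // k _; rewrite ?ltr_nat// ler_nat.
  have [t [t0 tL tle tcell]] := Gamma_chain _ _ _ _ _ _ _ Gid Gid S0 Sn SS T0 Tm TT.
  by do 2 eexists; exact: (Gamma_cell_chain _ _ _ _ _ _ _ _ Gid Gid t0 tL tle tcell).
have [x [y [[x0 y0 xL yL xy] max_xy]]] := chain_value_max R N n m S T c d ex_chain.
pose W := cell_weight R N m c d; pose L := (n * m)%N.
pose x' := stair_x R x; pose y' := stair_y R W y.
have L'0 : (0 < L.*2)%N by rewrite double_gt0.
have kcase k : (k < L.*2)%N -> (k./2 < L)%N /\ (k = k./2.*2 \/ k = k./2.*2.+1).
  by move=> kL; rewrite -{2 4}[k]odd_double_half; case: (odd k); lia.
have x'0 : x' 0%N = 0 by [].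
have y'0 : y' 0%N = 0 by [].
have x'L : x' L.*2 = 1 by rewrite /x' stair_x_double.
have y'L : y' L.*2 = 1 by rewrite /y' stair_y_double.
have x'le k : (k < L.*2)%N -> x' k <= x' k.+1.
  move=> /kcase[/xy[h _ _] [->|->]]; rewrite /x' -?doubleS.
    by rewrite stair_x_doubleS stair_x_double.
  by rewrite stair_x_doubleS stair_x_double.
have y'le k : (k < L.*2)%N -> y' k <= y' k.+1.
  move=> /kcase[/xy[_ h _] [->|->]]; rewrite /y' -?doubleS.
    by rewrite stair_y_doubleS stair_y_double; case: ifP.
  by rewrite stair_y_doubleS stair_y_double; case: ifP.
have q2 := L2_act_pl R N q n S c q_L2.1 S0 Sn Sq _ L'0 x' x'0 x'L x'le.
have w2 := L2_act_pl R N w m T d w_L2.1 T0 Tm Tw _ L'0 y' y'0 y'L y'le.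
have value : L2inner (act q (pl R L.*2 x')) (act w (pl R L.*2 y')) =
    chain_value R N n m c d x y.
  rewrite (act_pl_inner R N q w _ x' y' (fun k => W k./2) L'0)//; first exact: stair_sum.
  (* At odd [k] the path [x'] rests. At even [k], either the weight is nonpositive and [y'] rests,
     or the step is a whole step of the maximal chain, with the alternatives of [cell_chain]. *)
  move=> k /kcase[kL [kE|kE]]; last first.
    by constructor 1; rewrite kE /x' -doubleS stair_x_doubleS stair_x_double.
  have [_ _ hxy] := xy _ kL; rewrite kE /x' /y' -kE.
  have -> : stair_x R x k = x k./2 by rewrite kE stair_x_double -kE.
  have -> : stair_y R W y k = y k./2 by rewrite kE stair_y_double -kE.
  have -> : stair_x R x k.+1 = x k./2.+1 by rewrite [in LHS]kE stair_x_doubleS.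
  have -> : stair_y R W y k.+1 = if W k./2 <= 0 then y k./2 else y k./2.+1.
    by rewrite [in LHS]kE stair_y_doubleS.
  case: ifPn => _; first by constructor 2.
  case: hxy => [E|E|[h1 h2 h3 h4]]; [by constructor 1|by constructor 2|constructor 3].
  have m0 : (0 < m)%N by move: L0; rewrite muln_gt0 => /andP[].
  move=> s r /andP[s1 s2] /andP[r1 r2].
  rewrite (Sq (k./2 %/ m)%N) ?ltn_divLR//; last first.
    by rewrite (le_lt_trans h1 s1) (lt_le_trans s2 h2).
  rewrite (Tw (k./2 %% m)%N) ?ltn_mod//.
  by rewrite (le_lt_trans h3 r1) (lt_le_trans r2 h4).
exists (pl R L.*2 x'), (pl R L.*2 y'); split.
- exact: pl_piecewise_linear.
- exact: pl_piecewise_linear.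
- exact: pl_Gamma_tilde.
- exact: pl_Gamma_tilde.
apply/eqP; rewrite eq_le; apply/andP; split.
  (* The two actions themselves lie in the orbit closures, so their inner product is one of the
     competitors. *)
  apply: ereal_sup_ubound; exists (act q (pl R L.*2 x')), (act w (pl R L.*2 y')).
  split => //.
    exact: (act_pl_in_orbit_closure R N q n S c q_L2.1 S0 Sn Sq _ _ L'0).
  exact: (act_pl_in_orbit_closure R N w m T d w_L2.1 T0 Tm Tw _ _ L'0).
apply: ge_ereal_sup => _ [qt [wt [cq cw ->]]]; rewrite lee_fin value.
exact: (orbit_closure_inner_le R N q w n m S T c d S0 Sn SS Sq T0 Tm TT Tw _ _ _
  q_L2.1 w_L2.1 max_xy).
Qed.
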